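(* Let $n$ be a nonnegative integer. There is a bijection between any pair of the following sets: (1) the set $\mathcal{F}_n$ of $F$-paths of length $n$; (2) the set $\mathcal{P}_n$ of Schröder paths of semilength $n$ without triple descents; (3) the set $\mathcal{B}_{n+1}$ of restricted bicolored Dyck paths of semilength $n+1$; (4) the set $\mathcal{S}_{n+1}$ of $(2341,2431,3241)$-avoiding permutations of $\{1,2,\dots,n+1\}$; (5) the set $\mathcal{I}_{n+1}$ of $(101,102)$-avoiding inversion sequences of length $n+1$; (6) the set $\mathcal{J}_{n+1}$ of $(101,021)$-avoiding inversion sequences of length $n+1$; (7) the set $\mathcal{T}_{n+1}$ of weighted ordered trees with $n+1$ edges.
   Context: **$F$-paths.** Let $F=\{(a,b)\in\mathbb{Z}^2 : a\ge 1,\ b\le 1\}\cup\{(0,1)\}$. An $F$-path of length $n$ is a lattice path in $\mathbb{Z}^2$ starting at $(0,0)$ with $n$ steps $s_1,\dots,s_n\in F$ such that each visited point $(x_i,y_i)=s_1+\cdots+s_i$ satisfies $x_i\le y_i$ for $1\le i\le n$. **Schröder paths without triple descents.** A Schröder path of semilength $n$ is a lattice path from $(0,0)$ to $(2n,0)$ that never goes below the $x$-axis and consists of steps $u=(1,1)$, $d=(1,-1)$, $h=(2,0)$. It is without triple descents if it has no three consecutive steps $ddd$. **Restricted bicolored Dyck paths.** A Dyck path is a Schröder path with no step $h$. A bicolored Dyck path is a Dyck path with each down step colored black ($d_{\rm b}$) or red ($d_{\rm r}$). A restricted bicolored Dyck path of semilength $n\ge1$ is a bicolored Dyck path of semilength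 $n$ of the form $$u^{i_1}d_{\rm r}^{j_1}d_{\rm b}^{k_1}\cdots u^{i_{\ell-1}}d_{\rm r}^{j_{\ell-1}}d_{\rm b}^{k_{\ell-1}}u^{i_\ell}d_{\rm r}^{j_\ell}$$ with $\ell\ge1$, all $i_m\ge1$, all $k_m\ge 1$, all $j_m\ge0$, and $i_1+\cdots+i_\ell=j_1+\cdots+j_\ell+k_1+\cdots+k_{\ell-1}=n$. **Permutations.** A permutation $\pi$ contains a pattern $\sigma\in\mathfrak{S}_k$ if there are indices $i_1<\cdots<i_k$ such that $\pi(i_a)<\pi(i_b)$ if and only if $\sigma(a)<\sigma(b)$ for all $a,b$; otherwise it avoids $\sigma$. A $(2341,2431,3241)$-avoiding permutation avoids all three patterns. **Inversion sequences.** An inversion sequence of length $n$ is an integer sequence $(e_1,\dots,e_n)$ with $0\le e_i<i$ for all $i$. It is $(101,102)$-avoiding if there are no indices $i<j<k$ with $e_j<e_i=e_k$ or $e_j<e_i<e_k$. It is $(101,021)$-avoiding if there are no indices $i<j<k$ with $e_j<e_i=e_k$ or $e_i<e_k<e_j$. **Weighted ordered trees.** An ordered tree is a rooted tree in which the children of each vertex are linearly ordered. The outdegree $\deg^+(v)$ is the number of children of $v$; a leaf is a vertex of outdegree $0$; an interior vertex is a vertex that is neither the root nor a leaf. A weighted ordered tree is an ordered tree in which each interior vertex $v$ is assigned a weight $\mathrm{wt}(v)\in\{1,2,\dots,\deg^+(v)\}$. *)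

(* Defs.v *)
From mathcomp Require Import all_boot all_order all_fingroup all_algebra.
From mathcomp Require Import boolp classical_sets.

Set Implicit Arguments.
Unset Strict Implicit.
Unset Printing Implicit Defensive.

Import Order.TTheory GRing.Theory Num.Theory.

Local Open Scope classical_set_scope.

(* A lattice path from the origin is identified with its sequence of steps. *)
Definition path_end (s : seq (int * int)) : int * int := (\sum_(p <- s) p)%R.

Definition F_step : set (int * int) :=
  [set p | (1 <= p.1)%R /\ (p.2 <= 1)%R] `|` [set (0%R, 1%R)].

Definition F_paths (n : nat) : set (seq (int * int)) :=
  [set s | [/\ size s = n,
    forall p : int * int, p \in s -> F_step p
    & forall i, 1 <= i <= n ->
        ((path_end (take i s)).1 <= (path_end (take i s)).2)%R]].

Definition step_u : int * int := (1%R, 1%R).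
Definition step_d : int * int := (1%R, (- 1)%R).
Definition step_h : int * int := (2%R, 0%R).

Definition schroder_paths (n : nat) : set (seq (int * int)) :=
  [set s | [/\ forall p : int * int, p \in s -> p \in [:: step_u; step_d; step_h],
    path_end s = ((2 * n)%N%:Z, 0)%R
    & forall i, i <= size s -> (0 <= (path_end (take i s)).2)%R]].

Definition schroder_paths_no_ddd (n : nat) : set (seq (int * int)) :=
  [set s | schroder_paths n s /\ ~~ infix [:: step_d; step_d; step_d] s].

Definition dyck_paths (n : nat) : set (seq (int * int)) :=
  [set s | schroder_paths n s /\ step_h \notin s].

Inductive bicolored_step : Type := up | down_black | down_red.

Definition uncolor (c : bicolored_step) : int * int :=
  match c with
  | up => step_u
  | down_black | down_red => step_d
  end.

Definition bicolored_dyck_paths (n : nat) : set (seq bicolored_step) :=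
  [set s | dyck_paths n (map uncolor s)].

(* [bs] lists the triples (i_m, j_m, k_m) for m < l, and (i, j) is the final
   pair (i_l, j_l), so that l = size bs + 1. *)
Definition restricted_word (bs : seq (nat * nat * nat)) (i j : nat) :
    seq bicolored_step :=
  flatten [seq nseq b.1.1 up ++ nseq b.1.2 down_red ++ nseq b.2 down_black
          | b <- bs]
  ++ nseq i up ++ nseq j down_red.

Definition restricted_bicolored_dyck_paths (n : nat) :
    set (seq bicolored_step) :=
  [set s | bicolored_dyck_paths n s /\
    exists (bs : seq (nat * nat * nat)) (i j : nat),
      [/\ s = restricted_word bs i j,
          forall b : nat * nat * nat, b \in bs -> 1 <= b.1.1 /\ 1 <= b.2,
          1 <= i,
          (\sum_(b <- bs) b.1.1) + i = n
        & (\sum_(b <- bs) b.1.2) + j + (\sum_(b <- bs) b.2) = n]].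

(* Patterns are given in one-line notation.  ['S_n] permutes {0, ..., n-1}
   instead of {1, ..., n}, which does not affect pattern containment. *)
Definition contains_pattern (n : nat) (pi : 'S_n) (sigma : seq nat) : Prop :=
  exists f : 'I_(size sigma) -> 'I_n,
    (forall a b : 'I_(size sigma), a < b -> f a < f b) /\
    (forall a b : 'I_(size sigma),
       pi (f a) < pi (f b) <-> nth 0 sigma a < nth 0 sigma b).

Definition avoiding_perms (n : nat) (patterns : seq (seq nat)) : set 'S_n :=
  [set pi | forall sigma : seq nat, sigma \in patterns -> ~ contains_pattern pi sigma].

Arguments avoiding_perms : clear implicits.

(* The term e_i, for 1 <= i <= n, is [nth 0 e i.-1]. *)
Definition inversion_sequences (n : nat) : set (seq nat) :=
  [set e | size e = n /\ forall i, 1 <= i <= n -> nth 0 e i.-1 < i].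

Definition inversion_sequences_101_102 (n : nat) : set (seq nat) :=
  [set e | inversion_sequences n e /\
    ~ exists i j k : nat, i < j < k /\ k < n /\
        let x := nth 0 e i in let y := nth 0 e j in let z := nth 0 e k in
        (y < x /\ x = z) \/ (y < x /\ x < z)].

Definition inversion_sequences_101_021 (n : nat) : set (seq nat) :=
  [set e | inversion_sequences n e /\
    ~ exists i j k : nat, i < j < k /\ k < n /\
        let x := nth 0 e i in let y := nth 0 e j in let z := nth 0 e k in
        (y < x /\ x = z) \/ (x < z /\ z < y)].

(* Ordered trees whose vertices carry an optional weight; in a weighted ordered
   tree exactly the interior vertices have one. *)
Inductive tree : Type := Node of option nat & seq tree.

Fixpoint edges (t : tree) : nat :=
  let: Node _ ts := t in sumn [seq (edges t').+1 | t' <- ts].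

Fixpoint non_root_weighted (t : tree) : bool :=
  let: Node w ts := t in
  match ts, w with
  | [::], None => true
  | _ :: _, Some k => 1 <= k <= size ts
  | _, _ => false
  end && all non_root_weighted ts.

Definition weighted_trees (n : nat) : set tree :=
  [set t | edges t = n /\
    exists2 ts, t = Node None ts & all non_root_weighted ts].

(* Main.v *)
Require Import Defs.
From Stdlib Require List.
From mathcomp Require Import all_boot all_order all_fingroup all_algebra.
From mathcomp Require Import boolp classical_sets.
From mathcomp Require Import zify.

(** Code an F-step (a, b) by the pair (a, c) with c = 1 - b.  The F-paths of
length n become the words of length n over the letters (a, c), where a = 0 only
for (0, 0), such that the sum of a + c over every prefix is at most the length
of that prefix ([codes]).  A code has a height, its length minus its total
weight, and it can be extended by exactly the letters with a + c at most the
height plus one.  So the codes are the vertices at depth n of a generating tree,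
and any family with the same generating tree has as many members
([codes_succession]).  Three families have it.

- Weighted forests: a letter replaces the last a + c trees of the forest by one
  tree with these as children and with root weight a (a leaf if a + c = 0); the
  height is the number of trees minus one.

- (101,102)-avoiding inversion sequences: if m is the maximum and L the length
  of the longest weakly increasing prefix, a letter inserts the value m + a at
  position L - c.  The new entry is the last maximum, so erasing the last
  maximum recovers the parent; the height is L - m - 1.

- (101,021)-avoiding inversion sequences: such a sequence is a block of zeros
  followed by a word in which the positive entries increase weakly and equal
  ones are not separated by a zero.  A letter adds one to all positive entries,
  puts a zero in front, and turns the last a + c of the leading zeros into a
  ones followed by c zeros; the height is the number of leading zeros minus one.

Restricted bicolored Dyck paths are read off directly: the letter (a, c) stands
for an up step followed by c red and a black down steps, and a last up step
followed by red steps only leads back to the axis.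

For Schröder paths and permutations a recursive decomposition is compared
instead.  The last tree of a weighted forest is a leaf, or its children split
at the weight of the root into a nonempty forest f and a forest s.  A forest is
therefore empty, a forest z and a leaf, or a triple (z, f, s) with f nonempty,
and each family with such a decomposition is a copy of the algebra of shapes
([shapes_decomposition]).

- In a permutation of the required kind written L N R, with N its maximum,
  either L is empty or, with M the maximum of L, all other entries of L are
  smaller than all of R, and R consists of entries below M followed by entries
  above M.  So L, and the two parts of R, are arbitrary and give f, s and z.

- A nonempty Schröder path without triple descents ends with a step u or h
  followed by at most two down steps.  What precedes them ends at height at most
  two, and the last passages from each level to the next cut it into at most
  three paths of the same kind. *)

Set Implicit Arguments.
Unset Strict Implicit.
Unset Printing Implicit Defensive.

Definition equipotent (A B : Type) : Prop := exists f : A -> B, bijective f.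

Lemma equipotent_sym A B : equipotent A B -> equipotent B A.
Proof. by case=> f [g fK gK]; exists g, f. Qed.

Lemma equipotent_trans B A C :
  equipotent A B -> equipotent B C -> equipotent A C.
Proof. by case=> f f_bij [g g_bij]; exists (g \o f); apply: bij_comp. Qed.

Lemma equipotent_sets (T U : Type) (A : set T) (B : set U) (f : T -> U) :
    (forall x, A x -> B (f x)) ->
    (forall x y, A x -> A y -> f x = f y -> x = y) ->
    (forall y, B y -> exists2 x, A x & f x = y) ->
  equipotent (set_type A) (set_type B).
Proof.
move=> fAB f_inj f_surj.
pose F (x : set_type A) : set_type B := SigSub (mem_set (fAB _ (set_valP x))).
have /choice[G GP] (y : set_type B) : exists x, F x = y.
  have [x Ax fx] := f_surj _ (set_valP y).
  by exists (SigSub (mem_set Ax)); apply/val_inj.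
exists F, G => // x; apply/val_inj/f_inj; try exact: set_valP.
by have /(congr1 val) := GP (F x).
Qed.

(** * Ballot codes *)

Definition wt (w : seq (nat * nat)) : nat := \sum_(p <- w) (p.1 + p.2).

Definition step_ok (p : nat * nat) : bool := (p.1 == 0) ==> (p.2 == 0).

(** The letter [(a, c)] is the F-step [(a, 1 - c)]; the prefix condition says
that the point reached satisfies [x <= y]. *)
Definition codes (n : nat) : set (seq (nat * nat)) :=
  [set w | [/\ size w = n, all step_ok w
    & forall i, i <= n -> wt (take i w) <= i]].

Lemma wt_cat w1 w2 : wt (w1 ++ w2) = wt w1 + wt w2.
Proof. by rewrite /wt big_cat. Qed.

Lemma wt_rcons w p : wt (rcons w p) = wt w + (p.1 + p.2).
Proof. by rewrite -cats1 wt_cat /wt big_seq1. Qed.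

Lemma wt_codes n w : codes n w -> wt w <= n.
Proof. by case=> sz _ /(_ n (leqnn n)); rewrite -{1}sz take_size. Qed.

Lemma codes0 w : codes 0 w <-> w = [::].
Proof.
split=> [[/size0nil] //|->]; split=> // i.
by rewrite leqn0 => /eqP->; rewrite /wt big_nil.
Qed.

Lemma codes_rcons n w p :
  codes n.+1 (rcons w p) <->
  [/\ codes n w, step_ok p & wt w + (p.1 + p.2) <= n.+1].
Proof.
split=> [[]|[[sz ok bal] okp bal1]].
  rewrite size_rcons all_rcons => -[sz] /andP[okp okw] bal; split=> //.
    split=> // i le_in; have := bal i (leqW le_in).
    by rewrite -cats1 takel_cat // sz.
  by have := bal n.+1 (leqnn _); rewrite take_oversize ?size_rcons ?sz // wt_rcons.
split; [by rewrite size_rcons sz | by rewrite all_rcons okp |] => i.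
rewrite leq_eqVlt => /predU1P[->|lt_in].
  by rewrite take_oversize ?size_rcons ?sz // wt_rcons.
by rewrite -cats1 takel_cat ?sz //; apply: bal.
Qed.

(** A family in which an object of height [h x] has one child for each letter
of weight at most [h x + 1], the child losing that weight and gaining one, and
in which every object other than the root has a unique parent, is the generating
tree of the codes: a code lists the choices made on the way down from the
root. *)
Lemma codes_succession (T : Type) (X : nat -> set T) (x0 : T)
    (child : T -> nat * nat -> T) (h : T -> nat) :
  let valid x p := step_ok p /\ p.1 + p.2 <= (h x).+1 in
    (forall x, X 0 x <-> x = x0) -> h x0 = 0 ->
    (forall n x p, X n x -> valid x p ->
       X n.+1 (child x p) /\ h (child x p) + (p.1 + p.2) = (h x).+1) ->
    (forall n x y p q, X n x -> X n y -> valid x p -> valid y q ->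
       child x p = child y q -> x = y /\ p = q) ->
    (forall n y, X n.+1 y -> exists x p, [/\ X n x, valid x p & child x p = y]) ->
  forall n, equipotent (set_type (codes n)) (set_type (X n)).
Proof.
move=> valid X0 h0 closed inj surj n.
pose run := foldl child x0.
have run_rcons w p : run (rcons w p) = child (run w) p by apply: foldl_rcons.
have runP m w : codes m w -> X m (run w) /\ h (run w) + wt w = m.
  elim/last_ind: w m => [|w p IH] [|m].
  - by rewrite X0 /run /wt big_nil h0.
  - by case.
  - by case; rewrite size_rcons.
  case/codes_rcons => cw okp le_wt; have [Xw hw] := IH _ cw.
  have vp : valid (run w) p by split=> //; lia.
  have [] := closed _ _ _ Xw vp; rewrite run_rcons wt_rcons => ? ?.
  by split=> //; lia.
have run_valid m w p : codes m.+1 (rcons w p) -> codes m w /\ valid (run w) p.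
  by case/codes_rcons => cw okp le_wt; have [_ hw] := runP _ _ cw; do 2!split=> //; lia.
apply: (equipotent_sets (f := run)) => [w /runP[]//| |].
  elim: n => [|n IH] w1 w2; first by move=> /codes0-> /codes0->.
  case/lastP: w1 => [[]//|w1 p1]; case/lastP: w2 => [_ []//|w2 p2].
  move=> /run_valid[c1 v1] /run_valid[c2 v2]; rewrite !run_rcons.
  by case/(inj n) => //; try exact: (runP _ _ _).1; move=> /IH-> // ->.
elim: n => [|n IH] y; first by rewrite X0 => ->; exists [::]; first exact/codes0.
move=> /surj[x [p [/IH[w cw <-] [okp le_p] <-]]].
exists (rcons w p); last by rewrite run_rcons.
by apply/codes_rcons; split=> //; have [_] := runP _ _ cw; lia.
Qed.

(** * F-paths *)

Definition F_step_of (p : nat * nat) : int * int := (p.1%:Z, 1 - p.2%:Z)%R.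

Lemma path_end_cons p s : path_end (p :: s) = (p + path_end s)%R.
Proof. exact: big_cons. Qed.

Lemma path_end_nil : path_end [::] = 0%R.
Proof. exact: big_nil. Qed.

Lemma path_end_F_steps w :
  ((path_end (map F_step_of w)).1 <= (path_end (map F_step_of w)).2)%R
    = (wt w <= size w).
Proof.
suff E : ((path_end (map F_step_of w)).2
          = (path_end (map F_step_of w)).1 + (size w)%:Z - (wt w)%:Z)%R.
  by rewrite E; lia.
elim: w => [|[a c] w IH]; first by rewrite path_end_nil /wt big_nil.
by rewrite /wt big_cons -/(wt w) /= path_end_cons /= IH; lia.
Qed.

Lemma codes_F_paths n : equipotent (set_type (codes n)) (set_type (F_paths n)).
Proof.
apply: (equipotent_sets (f := map F_step_of)) => [w [sz ok bal]|w1 w2 _ _|s].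
- split; first by rewrite size_map.
    move=> _ /mapP[[a c] /(allP ok) + ->]; rewrite /step_ok /F_step /=.
    case: a => [/eqP->|a _]; first by right.
    by left=> /=; lia.
  move=> i /andP[_ le_in]; rewrite -map_take path_end_F_steps size_takel ?sz //.
  exact: bal.
- by apply: inj_map => -[a1 c1] [a2 c2] [] ? ?; congr pair; lia.
- case=> sz steps ballot; pose code (p : int * int) := (`|p.1|%N, `|1 - p.2|%N)%R.
  have codeK : {in s, cancel code F_step_of}.
    move=> [a b] /steps[[/= a_ge1 b_le1]|[-> ->]] //.
    by rewrite /F_step_of /code /=; congr pair; lia.
  have codes_ok : all step_ok (map code s).
    apply/allP=> _ /mapP[[a b] /steps[[/= a_ge1 b_le1]|[-> ->]] ->] //.
    by rewrite /step_ok /=; lia.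
  have sE : map F_step_of (map code s) = s by rewrite -map_comp map_id_in.
  exists (map code s) => //; split; rewrite ?size_map //.
  case=> [|i] le_in; first by rewrite take0 /wt big_nil.
  have takeE : take i.+1 s = map F_step_of (take i.+1 (map code s)).
    by rewrite map_take sE.
  have := ballot i.+1; rewrite le_in takeE path_end_F_steps.
  by rewrite size_takel ?size_map ?sz //; apply.
Qed.

(** * Restricted bicolored Dyck paths *)

Definition is_up (c : bicolored_step) : bool := if c is up then true else false.

Definition nonneg (s : seq bicolored_step) : Prop :=
  forall i, i <= size s -> i <= 2 * count is_up (take i s).

Lemma path_end_uncolor s :
  path_end (map uncolor s)
    = ((size s)%:Z, (2 * count is_up s)%:Z - (size s)%:Z)%R.
Proof.
elim: s => [|x s IH]; first by rewrite path_end_nil.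
rewrite /= path_end_cons IH.
by case: x; congr pair => /=; lia.
Qed.

(** Counting up steps replaces the integer coordinates: a prefix of length [i]
is above the axis when at least half of its steps are up steps. *)
Lemma bicolored_dyck_pathsP n s :
  bicolored_dyck_paths n s <->
  [/\ size s = 2 * n, count is_up s = n & nonneg s].
Proof.
have prefixP i : i <= size s ->
    (0 <= (path_end (take i (map uncolor s))).2)%R
      = (i <= 2 * count is_up (take i s)).
  by move=> le_is; rewrite -map_take path_end_uncolor size_takel //=; lia.
split=> [[[_ +] nn _]|[sz cnt nn]].
  rewrite path_end_uncolor => -[sz cnt]; split; try lia.
  by move=> i le_is; rewrite -prefixP //; apply: nn; rewrite size_map.
split; last by elim: s {prefixP sz cnt nn} => [|[] s] //=.
split; last by move=> i; rewrite size_map => le_is; rewrite prefixP //; apply: nn.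
  by move=> p; elim: s {prefixP sz cnt nn} => [|[] s IH] //;
    rewrite in_cons => /orP[/eqP->|/IH].
by rewrite path_end_uncolor cnt sz; congr pair; lia.
Qed.

Lemma nonneg_cat_downs s t :
  nonneg s -> ~~ has is_up t -> size s + size t <= 2 * count is_up s ->
  nonneg (s ++ t).
Proof.
move=> nn down le_t i; rewrite size_cat take_cat; case: ltnP => [lt_is _|ge_is le_i].
  by apply: nn; lia.
rewrite count_cat; have := ge_is; lia.
Qed.

Lemma nonneg_rcons_up s : nonneg s -> nonneg (rcons s up).
Proof.
move=> nn i; rewrite size_rcons leq_eqVlt => /predU1P[->|lt_is].
  rewrite take_oversize ?size_rcons // -cats1 count_cat /=.
  by have := nn _ (leqnn _); rewrite take_size; lia.
by rewrite -cats1 takel_cat //; apply: nn.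
Qed.

Definition up_down_runs (w : seq (nat * nat)) : seq bicolored_step :=
  flatten [seq up :: nseq p.2 down_red ++ nseq p.1 down_black | p <- w].

(** The last up step is followed by red steps only, as many as are needed to
return to the axis. *)
Definition dyck_of_code (n : nat) (w : seq (nat * nat)) : seq bicolored_step :=
  up_down_runs w ++ up :: nseq (n.+1 - wt w) down_red.

Lemma up_down_runs_cat w1 w2 :
  up_down_runs (w1 ++ w2) = up_down_runs w1 ++ up_down_runs w2.
Proof. by rewrite /up_down_runs map_cat flatten_cat. Qed.

Lemma up_down_runs_ups k : up_down_runs (nseq k (0, 0)) = nseq k up.
Proof. by elim: k => //= k IH; rewrite -[in RHS]IH. Qed.

Lemma size_up_down_runs w : size (up_down_runs w) = size w + wt w.
Proof.
elim: w => [|p w IH]; first by rewrite /wt big_nil.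
by rewrite /= size_cat -/(up_down_runs w) IH /wt big_cons size_cat !size_nseq; lia.
Qed.

Lemma count_up_down_runs w : count is_up (up_down_runs w) = size w.
Proof.
elim: w => [|p w IH] //=.
by rewrite count_cat -/(up_down_runs w) IH count_cat !count_nseq.
Qed.

Lemma nonneg_up_down_runs n w : codes n w -> nonneg (up_down_runs w).
Proof.
elim/last_ind: w n => [|w [a c] IH] n; first by move=> _ [].
case: n => [[]|n]; first by rewrite size_rcons.
case/codes_rcons => cw _ /= le_wt; have [sz _ _] := cw.
rewrite -cats1 up_down_runs_cat [X in _ ++ X]cats0 -cat_rcons.
apply: nonneg_cat_downs; first by apply: nonneg_rcons_up; exact: IH cw.
  by rewrite has_cat !has_nseq !andbF.
rewrite -cats1 count_cat size_cat size_up_down_runs count_up_down_runs sz.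
by rewrite size_cat !size_nseq /=; lia.
Qed.

(** A maximal run of down steps is red, then black, so its word determines both
lengths; this is what makes the coding injective. *)
Lemma runs_inj (a1 a2 c1 c2 : nat) (s1 s2 : seq bicolored_step) :
  nseq c1 down_red ++ nseq a1 down_black ++ up :: s1
    = nseq c2 down_red ++ nseq a2 down_black ++ up :: s2 ->
  [/\ a1 = a2, c1 = c2 & s1 = s2].
Proof.
elim: c1 c2 => [|c1 IH] [|c2] /=; last by case=> /IH[-> -> ->].
- by elim: a1 a2 => [|a1 IH] [|a2] //= []; [move=> -> | case/IH => -> _ ->].
- by case: a1.
- by clear IH; case: a2.
Qed.

Lemma up_down_runs_head w n p :
  exists s, up_down_runs w ++ up :: nseq n p = up :: s.
Proof. by case: w => [|q w]; eexists. Qed.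

Lemma up_down_runs_inj w1 w2 n1 n2 : size w1 = size w2 ->
  up_down_runs w1 ++ up :: nseq n1 down_red
    = up_down_runs w2 ++ up :: nseq n2 down_red ->
  w1 = w2.
Proof.
elim: w1 w2 => [|[a1 c1] w1 IH] [|[a2 c2] w2] //= [sz] [].
have [s1 s1E] := up_down_runs_head w1 n1 down_red.
have [s2 s2E] := up_down_runs_head w2 n2 down_red.
rewrite -!catA -/(up_down_runs w1) -/(up_down_runs w2) s1E s2E.
by case/runs_inj => -> -> sE; rewrite (IH w2) // s1E s2E sE.
Qed.


Lemma restricted_word_rcons bs b i j :
  restricted_word (rcons bs b) i j
    = restricted_word bs b.1.1 b.1.2 ++ nseq b.2 down_black ++ nseq i up ++ nseq j down_red.
Proof. by rewrite /restricted_word map_rcons flatten_rcons -!catA. Qed.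

Lemma restricted_wordS bs i j :
  restricted_word bs i.+1 j = restricted_word bs i 0 ++ up :: nseq j down_red.
Proof. by rewrite /restricted_word -addn1 nseqD cats0 -!catA. Qed.

Lemma up_down_runs_restricted w : all step_ok w ->
  exists bs i, [/\ up_down_runs w = restricted_word bs i 0,
    forall b : nat * nat * nat, b \in bs -> 1 <= b.1.1 /\ 1 <= b.2,
    (\sum_(b <- bs) b.1.1) + i = size w
    & (\sum_(b <- bs) b.1.2) + (\sum_(b <- bs) b.2) = wt w].
Proof.
elim/last_ind: w => [_|w [a c] IH].
  by exists [::], 0; split; rewrite // /wt !big_nil.
rewrite all_rcons => /andP[ok_p /IH[bs [i [wE bs_ok sum1 sum2]]]].
rewrite wt_rcons size_rcons -cats1 up_down_runs_cat wE.
case: a ok_p => [/eqP/= -> | a _].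
  by exists bs, i.+1; split=> //; rewrite ?restricted_wordS //; lia.
exists (rcons bs (i.+1, c, a.+1)), 0; split.
- by rewrite restricted_word_rcons restricted_wordS /= !cats0 -catA /up_down_runs /= cats0.
- by move=> b; rewrite mem_rcons in_cons => /predU1P[->|/bs_ok].
- by rewrite -cats1 big_cat big_seq1 /= -sum1; lia.
- by rewrite -cats1 !big_cat !big_seq1 /= -sum2; lia.
Qed.

(** In a block of [i] up steps only the last one is followed by down steps; the
other ones are letters [(0, 0)].  The up step of the final block that precedes
the red run is not part of the code, hence [i.-1]. *)
Definition code_of_blocks (bs : seq (nat * nat * nat)) (i : nat) : seq (nat * nat) :=
  flatten [seq rcons (nseq b.1.1.-1 (0, 0)) (b.2, b.1.2) | b <- bs]
  ++ nseq i.-1 (0, 0).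

Lemma up_down_runs_blocks bs i j : 0 < i ->
    (forall b : nat * nat * nat, b \in bs -> 1 <= b.1.1 /\ 1 <= b.2) ->
  up_down_runs (code_of_blocks bs i) ++ up :: nseq j down_red
    = restricted_word bs i j.
Proof.
case: i => // i _ bs_ok; rewrite restricted_wordS; congr cat.
elim: bs bs_ok => [|[[i1 j1] k1] bs IH] bs_ok.
  by rewrite /code_of_blocks /= up_down_runs_ups /restricted_word /= cats0.
have [/= i1_gt0 _] := bs_ok _ (mem_head _ _).
rewrite /code_of_blocks /= -catA up_down_runs_cat IH; last first.
  by move=> b b_bs; apply: bs_ok; rewrite in_cons b_bs orbT.
rewrite -cats1 up_down_runs_cat up_down_runs_ups /restricted_word /= !cats0.
by rewrite -[in RHS](prednK i1_gt0) -[in RHS]addn1 nseqD -!catA /= -!catA.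
Qed.

Lemma size_code_of_blocks bs i : 0 < i ->
    (forall b : nat * nat * nat, b \in bs -> 1 <= b.1.1 /\ 1 <= b.2) ->
  [/\ (size (code_of_blocks bs i)).+1 = (\sum_(b <- bs) b.1.1) + i,
      wt (code_of_blocks bs i) = (\sum_(b <- bs) b.1.2) + (\sum_(b <- bs) b.2)
    & all step_ok (code_of_blocks bs i)].
Proof.
have wt0 k : wt (nseq k (0, 0)) = 0 by rewrite /wt big_nseq; elim: k => //= k ->.
move=> i_gt0; elim: bs => [|[[i1 j1] k1] bs IH] bs_ok.
  by rewrite /code_of_blocks /= wt0 size_nseq !big_nil prednK // all_nseq orbT.
have [/= i1_gt0 k1_gt0] := bs_ok _ (mem_head _ _).
have [|szE wtE ok] := IH.
  by move=> b b_bs; apply: bs_ok; rewrite in_cons b_bs orbT.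
rewrite /code_of_blocks /= -catA -/(code_of_blocks bs i) size_cat wt_cat all_cat.
rewrite ok wtE !big_cons /=.
rewrite size_rcons size_nseq wt_rcons wt0 all_rcons all_nseq /step_ok /= orbT.
by split; [rewrite prednK // -addnS szE addnA | lia | case: (k1) k1_gt0].
Qed.

Lemma codes_bicolored n :
  equipotent (set_type (codes n)) (set_type (restricted_bicolored_dyck_paths n.+1)).
Proof.
apply: (equipotent_sets (f := dyck_of_code n)) => [w cw|w1 w2 [sz1 _ _] [sz2 _ _]|s].
- have [sz ok _] := cw; have le_wt := wt_codes cw.
  have [bs [i [wE bs_ok sum1 sum2]]] := up_down_runs_restricted ok.
  split; last first.
    by exists bs, i.+1, (n.+1 - wt w); rewrite restricted_wordS -wE; split=> //; lia.
  apply/bicolored_dyck_pathsP; rewrite /dyck_of_code.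
  rewrite size_cat count_cat size_up_down_runs count_up_down_runs /=.
  rewrite size_nseq count_nseq /= sz; split; try lia.
  rewrite -cat_rcons; apply: nonneg_cat_downs.
  + exact/nonneg_rcons_up/nonneg_up_down_runs/cw.
  + by rewrite has_nseq andbF.
  + rewrite -cats1 size_cat count_cat size_up_down_runs count_up_down_runs /=.
    by rewrite size_nseq sz; lia.
- by apply: up_down_runs_inj; rewrite sz1.
- case=> /bicolored_dyck_pathsP[sz cnt nn] [bs [i [j [sE bs_ok i_gt0 sum1 sum2]]]].
  have [szE wtE ok] := size_code_of_blocks i_gt0 bs_ok.
  move: sum2; rewrite addnAC -wtE => sum2; move: szE; rewrite sum1 => -[szE].
  have runsE := up_down_runs_blocks j i_gt0 bs_ok.
  exists (code_of_blocks bs i).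
    split=> // k le_kn.
    have le_k : k <= size (code_of_blocks bs i) by lia.
    have splitE := cat_take_drop k (code_of_blocks bs i).
    have := nn (size (up_down_runs (take k (code_of_blocks bs i)))).
    rewrite sE -runsE -[in X in up_down_runs X ++ _]splitE up_down_runs_cat -catA.
    rewrite take_size_cat // size_cat leq_addr => /(_ isT).
    by rewrite count_up_down_runs size_up_down_runs size_takel //; lia.
  by rewrite sE -runsE /dyck_of_code; congr (_ ++ _ :: nseq _ _); lia.
Qed.

(** * Weighted ordered trees *)

Definition forest_edges (ts : seq tree) : nat := sumn [seq (edges t).+1 | t <- ts].

Definition weighted_forests (n : nat) : set (seq tree) :=
  [set ts | forest_edges ts = n /\ all non_root_weighted ts].

Definition leaf : tree := Node None [::].

Lemma forest_edges_cat ts1 ts2 :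
  forest_edges (ts1 ++ ts2) = forest_edges ts1 + forest_edges ts2.
Proof. by rewrite /forest_edges map_cat sumn_cat. Qed.

Lemma forest_edges_rcons ts w ch :
  forest_edges (rcons ts (Node w ch)) = (forest_edges (ts ++ ch)).+1.
Proof. by rewrite -cats1 !forest_edges_cat /forest_edges /= addn0 addnS. Qed.

Lemma forest_edges0 ts : forest_edges ts = 0 -> ts = [::].
Proof. by case: ts. Qed.

(** Leaves carry no weight, so that the letter [(0, 0)] adds a leaf. *)
Definition weight_of (a : nat) : option nat := if a is 0 then None else Some a.

Lemma weight_ofK w ch :
  non_root_weighted (Node w ch) -> weight_of (odflt 0 w) = w.
Proof. by case: w ch => [[|k]|] [|t ch]. Qed.

Lemma non_root_weighted_Node a c ch : size ch = a + c ->
  non_root_weighted (Node (weight_of a) ch)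
    = step_ok (a, c) && all non_root_weighted ch.
Proof.
rewrite /step_ok /=; case: ch a c => [|t ch] [|a] [|c] //= [->].
by rewrite addn0 leqnn.
by rewrite !ltnS leq_addr.
Qed.

(** The removed trees can be read off the new last root, and the letter from its
weight and its number of children, which makes the step reversible. *)
Definition graft (ts : seq tree) (p : nat * nat) : seq tree :=
  let k := size ts - (p.1 + p.2) in
  rcons (take k ts) (Node (weight_of p.1) (drop k ts)).

Lemma codes_weighted_forests n :
  equipotent (set_type (codes n)) (set_type (weighted_forests n.+1)).
Proof.
have wf_gt0 m ts : weighted_forests m.+1 ts -> 0 < size ts by case: ts => [[]|].
apply: (@codes_succession _ (fun m => weighted_forests m.+1) [:: leaf] graft
          (fun ts => (size ts).-1)) => [ts||m ts [a c] Xts [okp le_p]| |] //.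
- split=> [[]|-> //]; case: ts => [//|[w ch] [|t ts]] //= [].
    move=> /eqP; rewrite addn0 => /eqP ch0; rewrite (forest_edges0 ch0).
    by case: w.
  by rewrite addnS.
- have /= ts_gt0 := wf_gt0 _ _ Xts; rewrite (prednK ts_gt0) in le_p.
  have [tsE ts_ok] := Xts; rewrite /graft; set k := _ - _.
  have sz_ch : size (drop k ts) = a + c by rewrite size_drop subKn.
  split; last by rewrite size_rcons size_take /k; move: le_p => /=; case: ifP; lia.
  split; first by rewrite forest_edges_rcons cat_take_drop tsE.
  move: ts_ok; rewrite -{1}(cat_take_drop k ts) all_cat all_rcons => /andP[-> ok_ch].
  by rewrite (non_root_weighted_Node sz_ch) okp ok_ch.
- move=> m ts1 ts2 [a1 c1] [a2 c2] X1 X2 [ok1 le1] [ok2 le2].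
  rewrite /graft /=; set k1 := _ - _; set k2 := _ - _.
  rewrite (prednK (wf_gt0 _ _ X1)) in le1; rewrite (prednK (wf_gt0 _ _ X2)) in le2.
  move=> /rcons_inj[takeE weightE dropE].
  have tsE : ts1 = ts2 by rewrite -(cat_take_drop k1 ts1) takeE dropE cat_take_drop.
  have : size (drop k1 ts1) = size (drop k2 ts2) by rewrite dropE.
  rewrite !size_drop !subKn // => szE; split=> //.
  have aE : a1 = a2 by case: (a1) (a2) weightE => [|?] [|?] // [->].
  by move: szE; rewrite aE => /addnI->.
- move=> m ts [tsE ts_ok]; case/lastP: ts tsE ts_ok => [//|ts [w ch]].
  rewrite forest_edges_rcons all_rcons => -[tsE] /andP[ok_t ok_ts].
  set a := odflt 0 w; set c := size ch - a.
  have ok_ch : all non_root_weighted ch by case/andP: ok_t.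
  have szE : size ch = a + c.
    by rewrite /c /a; case: (w) (ch) ok_t => [k|] [|t s] //= /andP[/andP[_ le_k] _]; lia.
  exists (ts ++ ch), (a, c); split.
  + by split; rewrite ?all_cat ?ok_ts.
  + split; last by rewrite size_cat /= szE; move: tsE; lia.
    by have := ok_t; rewrite -{1}(weight_ofK ok_t) (non_root_weighted_Node szE) => /andP[].
  + rewrite /graft /= size_cat -szE addnK take_size_cat // drop_size_cat //.
    by rewrite (weight_ofK ok_t).
Qed.

Lemma weighted_forests_trees n :
  equipotent (set_type (weighted_forests n)) (set_type (weighted_trees n)).
Proof.
apply: (equipotent_sets (f := Node None)) => [ts [tsE ok]|ts1 ts2 _ _ []|t] //.
  by split=> //; exists ts.
by case=> + [ts tE ok]; rewrite tE => tsE; exists ts.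
Qed.

(** * Occurrences of patterns *)

Lemma subseq_consP (x : nat) (t s : seq nat) :
  subseq (x :: t) s <->
  exists i, [/\ i < size s, nth 0 s i = x & subseq t (drop i.+1 s)].
Proof.
elim: s => [|y s IH]; first by split=> // -[i []].
rewrite /=; case: eqP => [->|neq].
  split=> [sub|[[|i] [lt_i xE sub]]]; first by exists 0; rewrite drop0.
    by rewrite drop0 in sub.
  apply: subseq_trans sub _; rewrite /=; exact: drop_subseq.
rewrite IH; split=> [[i [lt_i xE sub]]|[[|i] [lt_i xE sub]]]; first by exists i.+1.
  by case: neq.
by exists i.
Qed.

Lemma subseq_cat_inv (T : eqType) (t s1 s2 : seq T) :
  subseq t (s1 ++ s2) ->
  exists t1 t2, [/\ t = t1 ++ t2, subseq t1 s1 & subseq t2 s2].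
Proof.
elim: s1 t => [|y s1 IH] t; first by exists [::], t.
case: t => [|x t] /=; first by exists [::], [::]; rewrite sub0seq.
case: eqP => [->|neq] /IH[t1 [t2 [tE sub1 sub2]]].
  by exists (y :: t1), t2; rewrite tE /= eqxx.
exists t1, t2; split=> //; case: t1 tE sub1 => [|z t1] //= [<- _] sub1.
by case: eqP neq.
Qed.

Lemma triple_subseqP (s : seq nat) (x y z : nat) :
  subseq [:: x; y; z] s <->
  exists i j k, [/\ i < j < k, k < size s,
    nth 0 s i = x, nth 0 s j = y & nth 0 s k = z].
Proof.
split=> [|[i [j [k [/andP[ij jk] lt_k <- <- <-]]]]].
  move/subseq_consP => [i [lt_i xE]].
  move/subseq_consP => [j [lt_j yE]].
  move/subseq_consP => [k [lt_k zE _]].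
  rewrite !size_drop in lt_j lt_k; rewrite !nth_drop in yE zE.
  by exists i, (i.+1 + j), (i.+1 + (j.+1 + k)); split=> //; lia.
apply/subseq_consP; exists i; split=> //; first by lia.
apply/subseq_consP; exists (j - i.+1); rewrite size_drop nth_drop subnKC //.
split=> //; first by lia.
apply/subseq_consP; exists (k - j.+1).
rewrite drop_drop size_drop nth_drop; split; rewrite ?sub0seq //; first by lia.
by congr nth; lia.
Qed.

Lemma sorted_leqP (s : seq nat) :
  (forall x y : nat, subseq [:: x; y] s -> x <= y) -> sorted leq s.
Proof.
move=> le_s; rewrite (sorted_pairwise leq_trans); elim: s le_s => //= x s IH le_s.
apply/andP; split.
  by apply/allP=> y ys; apply: le_s; rewrite eqxx sub1seq.
apply: IH => y z sub; apply: le_s; case: ifP => // _.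
by rewrite (subseq_trans _ sub) // subseq_cons.
Qed.

Lemma sorted_leq_pair (s : seq nat) (x y : nat) :
  sorted leq s -> subseq [:: x; y] s -> x <= y.
Proof.
by move=> s_sorted /(subseq_sorted leq_trans) /(_ s_sorted) /= /andP[].
Qed.

(** * Inversion sequences avoiding 101 and 102 *)

(** The two patterns together forbid that an entry is followed by a smaller one
and later by one at least as large as itself. *)
Definition avoids_101_102 (e : seq nat) : Prop :=
  forall x y z : nat, subseq [:: x; y; z] e -> ~ (y < x <= z).

Definition inversion_bound (e : seq nat) : Prop :=
  forall i, i < size e -> nth 0 e i <= i.

Lemma inversion_sequencesP n e :
  inversion_sequences n e <-> size e = n /\ inversion_bound e.
Proof.
split=> -[<- bound]; split=> // i.
  by move=> lt_i; apply: (bound i.+1).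
by case: i => // i /andP[_ lt_i]; apply: bound.
Qed.

Lemma inversion_sequences_101_102P n e :
  inversion_sequences_101_102 n e <->
  [/\ size e = n, inversion_bound e & avoids_101_102 e].
Proof.
split=> [[/inversion_sequencesP[sz bound] avoid]|[sz bound avoid]].
  split=> // x y z /triple_subseqP[i [j [k [ijk lt_k xE yE zE]]]] /andP[yx xz].
  apply: avoid; exists i, j, k; rewrite -sz; do 2!split=> //.
  by rewrite /= xE yE zE; move: xz; rewrite leq_eqVlt => /predU1P[]; [left|right].
split; first exact/inversion_sequencesP.
case=> i [j [k [ijk [lt_k bad]]]].
apply: (avoid (nth 0 e i) (nth 0 e j) (nth 0 e k)).
  by apply/triple_subseqP; exists i, j, k; rewrite sz.
by case: bad => -[-> ?]; lia.
Qed.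

Lemma last_max_exists (e : seq nat) : e != [::] ->
  exists e1 v e2, [/\ e = e1 ++ v :: e2, all (leq^~ v) e1 & all (ltn^~ v) e2].
Proof.
elim: e => [//|x [|y e] IH] _; first by exists [::], x, [::].
have [// | e1 [v [e2 [eE le1 lt2]]]] := IH.
have [xv|vx] := leqP x v.
  by exists (x :: e1), v, e2; rewrite eE /= xv.
exists [::], x, (y :: e); split=> //; rewrite eE all_cat /= vx.
apply/andP; split; first by apply: sub_all le1 => z /= /leq_ltn_trans; apply.
by apply: sub_all lt2 => z /= zv; apply: ltn_trans vx.
Qed.

(** The position of the last maximum is where both [e1 <= v] and [e2 < v] hold,
so the two decompositions cannot be shifted against each other. *)
Lemma last_max_unique e1 e2 f1 f2 (v w : nat) :
  e1 ++ v :: e2 = f1 ++ w :: f2 ->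
  all (leq^~ v) e1 -> all (ltn^~ v) e2 -> all (leq^~ w) f1 -> all (ltn^~ w) f2 ->
  [/\ e1 = f1, v = w & e2 = f2].
Proof.
elim: e1 f1 => [|x e1 IH] [|y f1] /=.
- by case=> -> ->.
- by case=> -> -> _; rewrite all_cat /= => /and3P[_ wy _] /andP[yw _]; lia.
- by case=> -> <- /andP[wv _] _ _; rewrite all_cat /= => /and3P[_ vw _]; lia.
- by case=> -> /IH{}IH /andP[_ ?] ? /andP[_ ?] ?; have [] := IH => // -> -> ->.
Qed.

Lemma avoids_101_102_subseq e f :
  subseq e f -> avoids_101_102 f -> avoids_101_102 e.
Proof. by move=> ef avoid x y z sub; apply: avoid; apply: subseq_trans ef. Qed.

(** The new entry [v] is not the last of a forbidden triple, because the entries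
before it are sorted; it is neither the first nor the middle one, because the
last entry of such a triple is at least as large as the two others and the
entries after [v] are smaller. *)
Lemma avoids_insert_max e1 v e2 :
    sorted leq e1 -> all (ltn^~ v) e2 -> avoids_101_102 (e1 ++ e2) ->
  avoids_101_102 (e1 ++ v :: e2).
Proof.
move=> e1_sorted lt2 avoid x y z /subseq_cat_inv[t1 [t2 [tE sub1 sub2]]].
have lt_v u t : subseq t e2 -> u \in t -> u < v.
  by move=> /mem_subseq sub /sub /(allP lt2).
case: t2 tE sub2 => [|u t2] tE.
  by move=> _; apply: avoid; rewrite tE cats0; apply: (subseq_trans sub1 (prefix_subseq _ _)).
rewrite /=; case: eqP => [uv sub2|_ sub2]; last first.
  by apply: avoid; rewrite tE; apply: cat_subseq.
rewrite {}uv in tE sub2; case: t1 tE sub1 => [|x1 [|y1 [|z1 t1]]] //=.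
- case=> -> yz _; rewrite -yz in sub2 => /andP[_].
  by have := lt_v z _ sub2; rewrite !inE eqxx orbT => /(_ isT); lia.
- case=> -> -> zE _; rewrite -zE in sub2.
  by have := lt_v z _ sub2; rewrite !inE eqxx => /(_ isT); lia.
- by case=> -> -> _ _ /(sorted_leq_pair e1_sorted); lia.
- by case=> _ _ _; case: t1.
Qed.

(** Sequences cut after their longest weakly increasing prefix.  By avoidance
everything after the prefix is smaller than its last entry, which is the
maximum. *)
Definition run_split (n : nat) : set (seq nat * seq nat) :=
  [set e | [/\ sorted leq e.1, e.1 != [::], all (ltn^~ (last 0 e.1)) e.2,
    inversion_bound (e.1 ++ e.2) & avoids_101_102 (e.1 ++ e.2)]
    /\ size (e.1 ++ e.2) = n].

Lemma sorted_rcons_all (s : seq nat) v :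
  sorted leq (rcons s v) = all (leq^~ v) s && sorted leq s.
Proof.
rewrite !(sorted_pairwise leq_trans) -cats1 pairwise_cat /= andbT.
by rewrite allrel1r.
Qed.

Lemma run_splitP n e :
  inversion_sequences_101_102 n.+1 e ->
  exists2 PS, run_split n.+1 PS & PS.1 ++ PS.2 = e.
Proof.
case/inversion_sequences_101_102P => sz bound avoid.
have [|e1 [v [e2 [eE le1 lt2]]]] := @last_max_exists e; first by case: (e) sz.
exists (rcons e1 v, e2); last by rewrite /= cat_rcons.
rewrite /run_split /= cat_rcons -eE; split=> //; split=> //.
- rewrite sorted_rcons_all le1; apply: sorted_leqP => x y sub.
  rewrite leqNgt; apply/negP => yx; apply: (avoid x y v); last first.
    rewrite yx; apply: (allP le1); apply: (mem_subseq sub); exact: mem_head.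
  rewrite eE -[[:: x; y; v]]/([:: x; y] ++ [:: v]); apply: cat_subseq => //.
  by rewrite sub1seq mem_head.
- by case: (e1).
- by rewrite last_rcons.
Qed.

Lemma run_split_unique m n PS QT : run_split m PS -> run_split n QT ->
  PS.1 ++ PS.2 = QT.1 ++ QT.2 -> PS = QT.
Proof.
case: PS QT => [P S] [Q T] [[/= P_s + S_lt _ _] _] [[/= Q_s + T_lt _ _] _].
case/lastP: P P_s S_lt => [//|P v]; case/lastP: Q Q_s T_lt => [//|Q w].
rewrite !last_rcons !sorted_rcons_all => /andP[Qw _] Tw /andP[Pv _] Sv _ _.
by rewrite !cat_rcons => /last_max_unique[] // -> -> ->.
Qed.

Lemma run_split_101_102 n :
  equipotent (set_type (run_split n.+1)) (set_type (inversion_sequences_101_102 n.+1)).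
Proof.
apply: (equipotent_sets (f := fun PS => PS.1 ++ PS.2)) => [[P S]|PS QT|e /run_splitP] //.
  by case=> -[/= _ _ _ bound avoid] sz; apply/inversion_sequences_101_102P.
exact: run_split_unique.
Qed.

(** The new maximum jumps over the last [c] entries of the increasing prefix; they
leave the prefix.  With prefix length [L] and maximum [m], the bound on the new
entry reads [m + a <= L - c], hence the height [L - m - 1]. *)
Definition insert_max (e : seq nat * seq nat) (p : nat * nat) : seq nat * seq nat :=
  let k := size e.1 - p.2 in
  (rcons (take k e.1) (last 0 e.1 + p.1), drop k e.1 ++ e.2).

Lemma last_run_le n e : run_split n e -> last 0 e.1 < size e.1.
Proof.
case: e => P S [[/= _ + _ bound _] _]; case/lastP: P bound => [//|P v] bound _.
have := bound (size P); rewrite nth_cat size_rcons leqnn nth_rcons ltnn eqxx.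
by rewrite last_rcons; apply; rewrite size_cat size_rcons; lia.
Qed.

Lemma last_max_run (P : seq nat) : sorted leq P -> all (leq^~ (last 0 P)) P.
Proof.
case/lastP: P => [//|P v]; rewrite sorted_rcons_all last_rcons all_rcons.
by rewrite leqnn => /andP[].
Qed.

Lemma codes_101_102 n :
  equipotent (set_type (codes n)) (set_type (inversion_sequences_101_102 n.+1)).
Proof.
apply: equipotent_trans (run_split_101_102 n).
apply: (@codes_succession _ (fun m => run_split m.+1) ([:: 0], [::]) insert_max
          (fun e => (size e.1 - last 0 e.1).-1)) => //.
- move=> [P S]; split=> [[[/= _ + _ bound _] sz]|[-> ->]].
    case: P bound sz => [//|x P] bound [/size0nil].
    case: P S bound => [|//] [|//] bound _ _.
    by have := bound 0 isT; rewrite /= leqn0 => /eqP->.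
  split=> //; split=> //=; first by case.
  by move=> x y z /=; case: ifP.
- move=> m e [a c] Xe [okp]; have lt_last := last_run_le Xe.
  case: e Xe lt_last => P S [[/= P_s P0 S_lt bound avoid] sz] lt_last.
  rewrite /insert_max /= => le_ac; have le_PL := last_max_run P_s.
  set k := size P - c; have szk : size (take k P) = k by rewrite size_takel // leq_subr.
  have lt_S : all (ltn^~ (last 0 P + a)) (drop k P ++ S).
    rewrite all_cat; case: (a) okp => [/eqP/= c0|a' _].
      by rewrite /k c0 subn0 drop_size addn0 S_lt.
    apply/andP; split; last by apply: sub_all S_lt => x /=; lia.
    apply/allP=> x /mem_drop /(allP le_PL) /=; lia.
  have takeP : sorted leq (take k P) by apply: take_sorted.
  split; last by rewrite size_rcons last_rcons szk /k; lia.
  split; last first.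
    by rewrite cat_rcons size_cat /= addnS -size_cat catA cat_take_drop sz.
  split=> //=.
  + rewrite sorted_rcons_all takeP andbT; apply/allP=> x /mem_take /(allP le_PL) /=; lia.
  + by case: (take k P).
  + by rewrite last_rcons.
  + move=> i; rewrite cat_rcons => lt_i; rewrite nth_cat szk.
    have b j : j < size (P ++ S) -> nth 0 (take k P ++ drop k P ++ S) j <= j.
      by rewrite catA cat_take_drop; apply: bound.
    have szE : size (take k P ++ drop k P ++ S) = size (P ++ S).
      by rewrite catA cat_take_drop.
    rewrite size_cat /= addnS -size_cat szE in lt_i.
    case: ltngtP => [lt_ik|lt_ki|->]; last by rewrite subnn /= /k; lia.
      have := b i; rewrite nth_cat szk lt_ik; apply.
      by move: lt_i; rewrite ltnS leq_eqVlt => /predU1P[iE|//]; move: lt_ik;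
        rewrite iE size_cat /k; lia.
    case: i lt_i lt_ki => // i lt_i lt_ki; rewrite subSn //=.
    have := b i lt_i; rewrite nth_cat szk ltnNge (lt_ki : k <= i) /=; lia.
  + by rewrite cat_rcons; apply: avoids_insert_max => //; rewrite catA cat_take_drop.
- move=> m e f [a c] [b d] Xe Xf [_ /= le_ac] [_ /= le_bd].
  have ltE := last_run_le Xe; have ltF := last_run_le Xf.
  rewrite /insert_max /= => -[takeE dropE].
  have {takeE}[takeE lastE] := rcons_inj takeE.
  have efE : e = f.
    apply: (run_split_unique Xe Xf).
    by rewrite -(cat_take_drop (size e.1 - c) e.1) -catA dropE takeE catA cat_take_drop.
  have := congr1 size takeE; rewrite -efE in lastE le_bd ltF *.
  rewrite !size_takel ?leq_subr // => ?; split=> //; congr pair; lia.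
- move=> m [P' S'] [[/= + + + bound avoid] sz].
  case/lastP: P' bound avoid sz => [//|e1 v] bound avoid sz.
  rewrite last_rcons sorted_rcons_all !cat_rcons in bound avoid sz * => /andP[le1 s1] _ lt2.
  have sub : subseq (e1 ++ S') (e1 ++ v :: S') by rewrite cat_subseq ?subseq_cons.
  have le_v : v <= size e1.
    by have := bound (size e1); rewrite size_cat /= nth_cat ltnn subnn; apply; lia.
  have [|[P S] XPS /= PSE] := @run_splitP m (e1 ++ S').
    apply/inversion_sequences_101_102P; split.
    + by move: sz; rewrite !size_cat /= addnS => -[].
    + move=> i lt_i; rewrite nth_cat; case: ltnP => [lt_ie|ge_ie].
        have := bound i; rewrite nth_cat lt_ie; apply.
        by rewrite size_cat /=; lia.
      have : nth 0 S' (i - size e1) < v.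
        by apply: (allP lt2); apply: mem_nth; rewrite ltn_subLR // -size_cat.
      by lia.
    + exact: avoids_101_102_subseq sub avoid.
  have lt_last := last_run_le XPS; have [[/= P_s P0 S_lt _ _] _] := XPS.
  have le_Pv : last 0 P <= v.
    have : last 0 P \in e1 ++ S'.
      by rewrite -PSE mem_cat; case: (P) P0 => // x s _; rewrite /= mem_last.
    by rewrite mem_cat => /orP[/(allP le1)|/(allP lt2)] /=; lia.
  have le_sz : size e1 <= size P.
    rewrite leqNgt; apply/negP => lt_sz.
    (* Otherwise the sorted word [e1] would contain [P] and the entry after it,
       which is smaller than the last entry of [P]. *)
    have nthE i : i < size e1 -> nth 0 e1 i = nth 0 (P ++ S) i.
      by move=> lt_i; rewrite PSE nth_cat lt_i.
    have P_gt0 : 0 < size P by rewrite lt0n size_eq0.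
    have : nth 0 e1 (size P).-1 <= nth 0 e1 (size P).
      apply: (sorted_leq_nth leq_trans leqnn) => //; rewrite ?inE ?leq_pred //.
      exact: leq_ltn_trans (leq_pred _) lt_sz.
    rewrite !nthE //; last exact: leq_ltn_trans (leq_pred _) lt_sz.
    rewrite !nth_cat ltnn subnn prednK // leqnn nth_last leqNgt => /negP; apply.
    apply: (allP S_lt); apply: mem_nth; rewrite lt0n size_eq0; apply/eqP => S0.
    by move: lt_sz; rewrite -[P]cats0 -S0 PSE size_cat; lia.
  have PE : P = e1 ++ drop (size e1) P.
    by rewrite -{1}(take_size_cat S' (erefl (size e1))) -PSE takel_cat // cat_take_drop.
  have S'E : drop (size e1) P ++ S = S'.
    by have := congr1 (drop (size e1)) PSE; rewrite {1}PE -catA !drop_size_cat.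
  exists (P, S), (v - last 0 P, size P - size e1); split=> //.
  + split; rewrite /step_ok /=; last by lia.
    apply/implyP; rewrite subn_eq0 => vP; have {vP le_Pv}vE : last 0 P = v by lia.
    rewrite -size_drop size_eq0; case DE: (drop _ P) => [//|x D].
    have : v \in S'.
      by rewrite -S'E DE mem_cat -vE PE DE last_cat /= mem_last.
    by move/(allP lt2); rewrite /= ltnn.
  + by rewrite /insert_max /= subKn // subnKC // S'E {1}PE take_size_cat.
Qed.

(** * Inversion sequences avoiding 101 and 021 *)

Definition bound_from (k : nat) (s : seq nat) : Prop :=
  forall i, i < size s -> nth 0 s i <= k + i.

Lemma bound_from_cat k s1 s2 :
  bound_from k (s1 ++ s2) <-> bound_from k s1 /\ bound_from (k + size s1) s2.
Proof.
split=> [b|[b1 b2] i].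
  split=> i lt_i; first by have := b i; rewrite nth_cat lt_i size_cat ltn_addr //; apply.
  have := b (size s1 + i); rewrite nth_cat size_cat ltn_add2l lt_i.
  by rewrite ltnNge leq_addr addKn addnA; apply.
rewrite size_cat nth_cat; case: (ltnP i (size s1)) => [lt_i _|ge_i lt_i]; first exact: b1.
by have := b2 (i - size s1); rewrite -addnA subnKC // ltn_subLR //; apply.
Qed.

Lemma bound_from_nseq k m v : v <= k -> bound_from k (nseq m v).
Proof. by move=> le_vk i _; rewrite nth_nseq; case: ifP; lia. Qed.

(** What avoiding 021 and 101 means for the word after the leading zeros: a
zero in front turns every descent to a positive entry into an occurrence of 021,
and once the positive entries increase weakly only a zero can be the middle of
an occurrence of 101. *)
Definition separated (s : seq nat) : Prop :=
  (forall x y : nat, subseq [:: x; y] s -> 0 < y -> x <= y) /\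
  (forall x : nat, 0 < x -> ~~ subseq [:: x; 0; x] s).

Lemma separated_cons v s :
  separated (v :: s) <->
  [/\ separated s, forall y, y \in s -> 0 < y -> v <= y
    & 0 < v -> ~~ subseq [:: 0; v] s].
Proof.
split=> [[mono sep]|[[mono sep] le_v sep_v]].
  split; last by move=> v_gt0; have := sep v v_gt0; rewrite /= eqxx.
    split=> [x y sub|x x_gt0].
      by apply: mono; apply: subseq_trans sub (subseq_cons _ _).
    by apply: contra (sep x x_gt0) => sub; apply: subseq_trans sub (subseq_cons _ _).
  by move=> y ys; apply: mono; rewrite /= eqxx sub1seq.
split=> [x y|x]; rewrite /=; case: eqP => [->|_]; rewrite ?sub1seq.
- exact: le_v.
- exact: mono.
- exact: sep_v.
- exact: sep.
Qed.

Lemma separated_subseq s t : subseq s t -> separated t -> separated s.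
Proof.
move=> st [mono sep]; split=> [x y sub|x x_gt0].
  exact: mono (subseq_trans sub st).
by apply: contra (sep x x_gt0) => /subseq_trans; apply.
Qed.

Lemma subseq_skip_zeros z p t s :
  0 < p -> subseq (p :: t) (nseq z 0 ++ s) = subseq (p :: t) s.
Proof. by case: p => // p _; elim: z => //= z ->. Qed.

Lemma inversion_sequences_101_021P n z s : 0 < z ->
  inversion_sequences_101_021 n (nseq z 0 ++ s) <->
  [/\ bound_from z s, separated s & z + size s = n].
Proof.
move=> z_gt0; have boundE : inversion_bound (nseq z 0 ++ s) <-> bound_from z s.
  rewrite -[inversion_bound _]/(bound_from 0 _) bound_from_cat size_nseq add0n.
  by split=> [[]//|b]; split=> //; apply: bound_from_nseq.
split=> [[/inversion_sequencesP[sz bound] avoid]|[bound [mono sep] sz]].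
  have occ x y w : subseq [:: x; y; w] (nseq z 0 ++ s) ->
      ~ ((y < x /\ x = w) \/ (x < w /\ w < y)).
    move=> /triple_subseqP[i [j [k [ijk lt_k xE yE wE]]]] bad; apply: avoid.
    by exists i, j, k; rewrite -sz /= xE yE wE.
  split; first exact/boundE; last by rewrite -sz size_cat size_nseq.
  split=> [x y sub y_gt0|x x_gt0].
    rewrite leqNgt; apply/negP => yx; apply: (occ 0 x y); last by right.
    rewrite -[[:: 0; x; y]]/([:: 0] ++ [:: x; y]) cat_subseq // sub1seq mem_nseq.
    by rewrite z_gt0.
  apply/negP => sub; apply: (occ x 0 x); last by left.
  by rewrite subseq_skip_zeros.
split; first by apply/inversion_sequencesP; rewrite boundE size_cat size_nseq.
case=> i [j [k [ijk [lt_k]]]] /=.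
set x := nth 0 _ i; set y := nth 0 _ j; set w := nth 0 _ k.
have sub : subseq [:: x; y; w] (nseq z 0 ++ s).
  by apply/triple_subseqP; exists i, j, k; rewrite size_cat size_nseq sz.
case=> [[yx xw]|[xw wy]].
  have x_gt0 : 0 < x by apply: leq_ltn_trans yx.
  rewrite subseq_skip_zeros // -xw in sub.
  have sub2 : subseq [:: x; y] s.
    by apply: subseq_trans sub; rewrite /= eqxx /= eqxx.
  have y0 : y = 0.
    by case: y yx sub sub2 => // y yx _ /mono /(_ isT); rewrite leqNgt yx.
  by move: (sep x x_gt0); rewrite -{1}y0 sub.
have w_gt0 : 0 < w by apply: leq_ltn_trans xw.
have y_gt0 : 0 < y by apply: leq_ltn_trans wy.
suff /mono /(_ w_gt0) : subseq [:: y; w] s by rewrite leqNgt wy.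
rewrite -(subseq_skip_zeros z) //; apply: subseq_trans sub; exact: subseq_cons.
Qed.

(** Sequences cut after their leading zeros; the default value of [head] makes
the condition void for an empty second part. *)
Definition zero_split (n : nat) : set (nat * seq nat) :=
  [set e | [/\ 0 < e.1, head 1 e.2 != 0, bound_from e.1 e.2, separated e.2
    & e.1 + size e.2 = n]].

Lemma split_run (v : nat) s : exists k r, s = nseq k v ++ r /\ head v.+1 r != v.
Proof.
elim: s => [|x s [k [r [sE r_v]]]]; first by exists 0, [::]; rewrite /= neq_ltn ltnSn orbT.
have [->|neq] := eqVneq x v; first by exists k.+1, r; rewrite sE.
by exists 0, (x :: s).
Qed.

Lemma run_unique (v : nat) k l r s : head v.+1 r != v -> head v.+1 s != v ->
  nseq k v ++ r = nseq l v ++ s -> k = l /\ r = s.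
Proof.
move=> r_v s_v; elim: k l => [|k IH] [|l] //=.
- by move=> rE; rewrite rE /= eqxx in r_v.
- by move=> sE; rewrite -sE /= eqxx in s_v.
- by case=> /IH[-> ->].
Qed.

Lemma zero_split_101_021 n :
  equipotent (set_type (zero_split n.+1)) (set_type (inversion_sequences_101_021 n.+1)).
Proof.
apply: (equipotent_sets (f := fun e => nseq e.1 0 ++ e.2)) => [[z s]|[z s] [w t]|e Je].
- by case=> /= z_gt0 _ *; apply/inversion_sequences_101_021P.
- by case=> /= _ s0 _ _ _ [/= _ t0 _ _ _] /(run_unique s0 t0)[-> ->].
- have [z [s [eE s0]]] := split_run 0 e.
  have z_gt0 : 0 < z.
    case: Je => /inversion_sequencesP[sz bound] _.
    case: z eE => // eE; case: s s0 eE => [|x t] s0 eE; first by rewrite eE in sz.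
    by have := bound 0; rewrite sz eE /= leqn0 (negPf s0) => /(_ isT).
  move: Je; rewrite eE inversion_sequences_101_021P // => -[bound sep sz].
  by exists (z, s).
Qed.

(** Raising the positive entries makes the value 1 available, and [predn] undoes
it. *)
Definition incr_pos (x : nat) : nat := if x is 0 then 0 else x.+1.

Lemma incr_posK : cancel incr_pos predn.
Proof. by case. Qed.

Lemma predK_pos x : x != 1 -> incr_pos x.-1 = x.
Proof. by case: x => [|[|x]]. Qed.

Lemma subseq_map_incr_pos t s :
  subseq (map incr_pos t) (map incr_pos s) = subseq t s.
Proof.
apply/idP/idP => [/(map_subseq predn)|]; last exact: map_subseq.
by rewrite -!map_comp !(eq_map incr_posK) !map_id.
Qed.

Lemma separated_incr_pos s : separated (map incr_pos s) <-> separated s.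
Proof.
split=> [[mono sep]|[mono sep]]; split.
- move=> x y sub y_gt0; have := mono (incr_pos x) (incr_pos y).
  rewrite -[[:: _; _]]/(map incr_pos [:: x; y]) subseq_map_incr_pos => /(_ sub).
  by case: x y y_gt0 {sub} => [|x] [|y] // _ /(_ isT).
- move=> x x_gt0; have := sep (incr_pos x).
  rewrite -[[:: _; _; _]]/(map incr_pos [:: x; 0; x]) subseq_map_incr_pos; apply.
  by case: x x_gt0.
- move=> x y sub y_gt0.
  have := map_subseq predn sub; rewrite -map_comp (eq_map incr_posK) map_id /=.
  move/mono; have : y \in map incr_pos s.
    by apply: (mem_subseq sub); rewrite !inE eqxx orbT.
  case/mapP => -[_ yE|y' _ -> /(_ isT) /=]; [by rewrite yE in y_gt0 | lia].
- move=> x x_gt0; apply/negP => sub.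
  have := map_subseq predn sub; rewrite -map_comp (eq_map incr_posK) map_id /=.
  apply/negP/sep; have : x \in map incr_pos s.
    by apply: (mem_subseq sub); rewrite !inE eqxx.
  by case/mapP => -[_ xE|x' _ -> //]; rewrite xE in x_gt0.
Qed.

Lemma bound_from_incr_pos k s : bound_from k.+1 (map incr_pos s) <-> bound_from k s.
Proof.
split=> b i; rewrite ?size_map => lt_i.
  by have := b i; rewrite size_map (nth_map 0) // => /(_ lt_i); case: nth.
by have := b i lt_i; rewrite (nth_map 0) //; case: nth.
Qed.

(** In terms of the whole sequence, the parent is obtained by decreasing the
positive entries and deleting the first zero; the letter [(a, c)] records the
number of ones and the number of zeros following them. *)
Definition insert_ones (e : nat * seq nat) (p : nat * nat) : nat * seq nat :=
  (e.1.+1 - (p.1 + p.2), nseq p.1 1 ++ nseq p.2 0 ++ map incr_pos e.2).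

Lemma mem1_incr_pos s : 1 \notin map incr_pos s.
Proof. by apply/mapP => -[[|x]]. Qed.

Lemma head_incr_pos s : head 1 s != 0 ->
  (head 1 (map incr_pos s) != 0) && (head 2 (map incr_pos s) != 1).
Proof. by case: s => [|[|x] s]. Qed.

Lemma separated_nseq1 a s : separated s -> 1 \notin s -> separated (nseq a 1 ++ s).
Proof.
move=> sep s1; elim: a => //= a IH; apply/separated_cons; split=> // _.
apply/negP; elim: a {IH} => //= sub; by move: s1; rewrite (mem_subseq sub).
Qed.

Lemma separated_nseq0 c s : separated s -> separated (nseq c 0 ++ s).
Proof. by move=> sep; elim: c => //= c IH; apply/separated_cons. Qed.

Lemma codes_101_021 n :
  equipotent (set_type (codes n)) (set_type (inversion_sequences_101_021 n.+1)).
Proof.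
apply: equipotent_trans (zero_split_101_021 n).
apply: (@codes_succession _ (fun m => zero_split m.+1) (1, [::]) insert_ones
          (fun e => e.1.-1)) => //.
- move=> [z s]; split=> [[/= z_gt0 _ _ _ sz]|[-> ->]].
    by congr pair; [lia | apply: size0nil; lia].
  by split=> //; split.
- move=> m [z s] [a c] [/= z_gt0 s0 bound sep sz] [okp /=]; rewrite prednK // => le_ac.
  have /andP[is0 is1] := head_incr_pos s0.
  split; last by rewrite /=; lia.
  split=> /=; first by lia.
  + by case: (a) okp => [/eqP/=->|].
  + apply/bound_from_cat; rewrite bound_from_cat !size_nseq; split.
      by apply: bound_from_nseq; lia.
    split; first exact: bound_from_nseq.
    by rewrite -addnA subnK 1?ltnW // bound_from_incr_pos.
  + apply: separated_nseq1; first exact/separated_nseq0/separated_incr_pos.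
    by rewrite mem_cat mem_nseq andbF mem1_incr_pos.
  + by rewrite !size_cat !size_nseq size_map; lia.
- move=> m [z s] [w t] [a c] [b d] [/= z_gt0 s0 _ _ _] [/= w_gt0 t0 _ _ _].
  rewrite !prednK // => -[_ le_ac] [_ le_bd] [] zw eqE.
  have /andP[is0 is1] := head_incr_pos s0; have /andP[it0 it1] := head_incr_pos t0.
  have aE : a = b.
    have := congr1 (count_mem 1) eqE; rewrite !count_cat !count_nseq /= !mul1n.
    by rewrite !(count_memPn _) ?mem1_incr_pos // !addn0.
  move: eqE; rewrite -aE => /eqP; rewrite eqseq_cat // eqxx => /eqP.
  case/(run_unique is0 it0) => cE /(inj_map (can_inj incr_posK)) ->.
  by rewrite cE; split=> //; congr pair; lia.
- move=> m [z s] [/= z_gt0 s0 bound sep sz].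
  have [a [r [sE r1]]] := split_run 1 s.
  have [c [x [rE x0 okp]]] :
      exists c x, [/\ r = nseq c 0 ++ x, head 1 x != 0 & step_ok (a, c)].
    case: a sE => [|a] sE; first by exists 0, r; rewrite -[r]sE.
    by have [c [x [rE x0]]] := split_run 0 r; exists c, x.
  have [mono sep0] := sep.
  have r_1 : 1 \notin r.
    case: r r1 sE {rE} => [//|u r] /= u1 sE; rewrite in_cons eq_sym (negPf u1) /=.
    rewrite -sub1seq; apply/negP => sub.
    have [u_gt1|] := ltnP 1 u.
      have : subseq [:: u; 1] s.
        by rewrite sE -[[:: u; 1]]cat0s cat_subseq ?sub0seq //= eqxx.
      by move/mono => /(_ isT); rewrite leqNgt u_gt1.
    case: u u1 sE => [|[]] // _; case: (a) => [|a'] sE; first by rewrite sE in s0.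
    move=> _; move/negP: (sep0 1 isT); apply; rewrite sE -[[:: 1; 0; 1]]/([:: 1] ++ [:: 0; 1]).
    by rewrite cat_subseq //= ?sub0seq // sub1seq.
  have x_1 : 1 \notin x by apply: contra r_1; rewrite rE mem_cat orbC => ->.
  have xK : map incr_pos (map predn x) = x.
    rewrite -map_comp map_id_in // => y yx; apply: predK_pos.
    by apply: contraNneq x_1 => <-.
  have eE : s = nseq a 1 ++ nseq c 0 ++ map incr_pos (map predn x).
    by rewrite xK -rE.
  (* The first entry after a lone leading zero would be at most 1, so a sequence
     without ones starts with two zeros. *)
  have z_gt : 1 < z + (a + c).
    case: (a) (c) sE rE okp => [|a'] c' sE rE okp; last by lia.
    rewrite /step_ok /= in okp; rewrite (eqP okp) !addn0.
    case: s bound sz s0 r1 sE {mono sep0 sep eE} => [|v s] bound sz s0 r1 sE.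
      by move: sz => /=; lia.
    have := bound 0 isT; rewrite /= addn0; apply: leq_trans.
    by move: s0 r1; rewrite -[r]sE /=; case: (v) => [|[]].
  exists ((z + (a + c)).-1, map predn x), (a, c); split.
  + move: bound sz; rewrite eE !bound_from_cat !size_nseq !size_cat !size_nseq size_map.
    case=> _ [_ bound] sz; split=> /=; first by lia.
    * by case: (x) x0 x_1 => [|[|[|y]] x'].
    * by apply/bound_from_incr_pos; rewrite prednK ?addnA //; lia.
    * apply/separated_incr_pos/(separated_subseq _ sep); rewrite eE catA.
      exact: suffix_subseq.
    * by move: sz; lia.
  + by split=> //=; lia.
  + by rewrite /insert_ones -eE /=; congr pair; lia.
Qed.

(** * Ternary decompositions *)

(** [Ternary z f s] stands for the forest [z] followed by a tree whose root has
the trees of [f], then those of [s], as children and the number of trees in [f]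
as weight; [Unary z] is [z] followed by a leaf.  Weights are positive, so [f]
has to be nonempty. *)
Inductive shape : Type :=
  | Empty
  | Unary of shape
  | Ternary of shape & shape & shape.

Fixpoint shape_size (t : shape) : nat :=
  match t with
  | Empty => 0
  | Unary z => (shape_size z).+1
  | Ternary z f s => (shape_size z + shape_size f + shape_size s).+1
  end.

Fixpoint shape_ok (t : shape) : bool :=
  match t with
  | Empty => true
  | Unary z => shape_ok z
  | Ternary z f s =>
      [&& shape_ok z, shape_ok f, shape_ok s & 0 < shape_size f]
  end.

Definition shapes (n : nat) : set shape :=
  [set t | shape_ok t /\ shape_size t = n].

(** If the empty object and the two constructors are jointly bijective onto the
family and add up sizes as for shapes, evaluation of shapes is a bijection: it
is injective by induction on shapes and surjective by induction on the size. *)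
Lemma shapes_decomposition (T : Type) (X : set T) (size : T -> nat) (e : T)
    (unary : T -> T) (ternary : T -> T -> T -> T) :
    X e -> size e = 0 -> (forall x, X x -> size x = 0 -> x = e) ->
    (forall z, X z -> X (unary z) /\ size (unary z) = (size z).+1) ->
    (forall z f s, X z -> X f -> X s -> 0 < size f ->
       X (ternary z f s) /\ size (ternary z f s) = (size z + size f + size s).+1) ->
    (forall z z', X z -> X z' -> unary z = unary z' -> z = z') ->
    (forall z f s z' f' s', X z -> X f -> X s -> 0 < size f ->
       X z' -> X f' -> X s' -> 0 < size f' ->
       ternary z f s = ternary z' f' s' -> [/\ z = z', f = f' & s = s']) ->
    (forall x z f s, X x -> X z -> X f -> X s -> 0 < size f ->
       unary x <> ternary z f s) ->
    (forall x, X x -> 0 < size x ->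
       (exists2 z, X z & unary z = x) \/
       exists z f s, [/\ X z, X f, X s, 0 < size f & ternary z f s = x]) ->
  forall n, equipotent (set_type (shapes n))
                       (set_type [set x | X x /\ size x = n]).
Proof.
move=> Xe e0 eE Xunary Xternary unary_inj ternary_inj unary_ternary cover n.
pose fix eval t := match t with
  | Empty => e
  | Unary z => unary (eval z)
  | Ternary z f s => ternary (eval z) (eval f) (eval s)
  end.
have evalP t : shape_ok t -> X (eval t) /\ size (eval t) = shape_size t.
  elim: t => [|z IHz|z IHz f IHf s IHs] //=; first by case/IHz => /Xunary[? ->] ->.
  case/and4P => /IHz[Xz zE] /IHf[Xf fE] /IHs[Xs sE] f_gt0.
  rewrite -fE in f_gt0; have [? ->] := Xternary _ _ _ Xz Xf Xs f_gt0.
  by rewrite zE fE sE.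
have neq x z f s : shape_ok (Unary x) -> shape_ok (Ternary z f s) ->
    eval (Unary x) <> eval (Ternary z f s).
  move=> /= /evalP[Xx _] /and4P[/evalP[Xz _] /evalP[Xf <-] /evalP[Xs _] f_gt0].
  exact: unary_ternary.
apply: (equipotent_sets (f := eval)) => [t [/evalP ? <-] //|t u [+ _] [+ _]|].
  elim: t u => [|z IHz|z IHz f IHf s IHs] [|z'|z' f' s'] ok_t ok_u E //;
    have [Xt t_sz] := evalP _ ok_t; have [Xu u_sz] := evalP _ ok_u;
    try by move: t_sz u_sz; rewrite E => ->.
  - by move: E => /= /unary_inj E; rewrite (IHz z') //; apply: E; apply: (evalP _ _).1.
  - by case: (neq _ _ _ _ ok_t ok_u).
  - by case: (neq _ _ _ _ ok_u ok_t).
  - case/and4P: ok_t => okz okf oks f_gt0; case/and4P: ok_u => okz' okf' oks' f'_gt0.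
    have [Xz _] := evalP _ okz; have [Xf fE] := evalP _ okf; have [Xs _] := evalP _ oks.
    have [Xz' _] := evalP _ okz'; have [Xf' fE'] := evalP _ okf'; have [Xs' _] := evalP _ oks'.
    rewrite -fE in f_gt0; rewrite -fE' in f'_gt0.
    have [/IHz-> // /IHf-> // /IHs-> //] :=
      ternary_inj _ _ _ _ _ _ Xz Xf Xs f_gt0 Xz' Xf' Xs' f'_gt0 E.
elim/ltn_ind: n => n IH x [Xx xn].
case: n => [|n] in IH xn *; first by exists Empty; rewrite //= (eE x).
have [|[z Xz zE]|[z [f [s [Xz Xf Xs f_gt0 xE]]]]] := cover x Xx; first by rewrite xn.
  have [_] := Xunary z Xz; rewrite zE xn => -[zn].
  have [t [ok_t tn] tE] := IH n (ltnSn n) z (conj Xz (esym zn)).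
  by exists (Unary t); rewrite /= ?tE //; split=> //=; rewrite tn.
have [_] := Xternary z f s Xz Xf Xs f_gt0; rewrite xE xn => -[szE].
have [|t1 [ok1 n1] E1] := IH (size z) _ z (conj Xz erefl); first by lia.
have [|t2 [ok2 n2] E2] := IH (size f) _ f (conj Xf erefl); first by lia.
have [|t3 [ok3 n3] E3] := IH (size s) _ s (conj Xs erefl); first by lia.
exists (Ternary t1 t2 t3); rewrite /= ?E1 ?E2 ?E3 //.
by split=> /=; [rewrite ok1 ok2 ok3 n2 | rewrite n1 n2 n3 szE].
Qed.

Lemma shapes_weighted_forests n :
  equipotent (set_type (shapes n)) (set_type (weighted_forests n)).
Proof.
have -> : weighted_forests n
    = [set ts | all non_root_weighted ts /\ forest_edges ts = n]%classic.
  by apply/funext => ts; apply/propext; split=> -[].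
have size_gt0 ts : (0 < size ts) = (0 < forest_edges ts) by case: ts.
apply: (@shapes_decomposition _ (all non_root_weighted) forest_edges [::]
  (rcons^~ leaf)
  (fun z f s => rcons z (Node (Some (size f)) (f ++ s)))) => //.
- by move=> ts _ /forest_edges0.
- by move=> z ok_z; rewrite all_rcons /= ok_z forest_edges_rcons cats0.
- move=> z f s ok_z ok_f ok_s f_gt0.
  rewrite all_rcons ok_z andbT forest_edges_rcons !forest_edges_cat addnA; split=> //.
  have -> : Some (size f) = weight_of (size f) by case: (f) f_gt0.
  rewrite (@non_root_weighted_Node _ (size s)) ?size_cat // all_cat ok_f ok_s.
  by rewrite /step_ok /=; case: (f) f_gt0.
- by move=> z z' _ _ /rcons_inj[].
- move=> z f s z' f' s' _ _ _ _ _ _ _ _ /rcons_inj[-> szE catE].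
  have fE : f = f' by rewrite -(take_size_cat s (erefl (size f))) catE szE take_size_cat.
  split=> //; rewrite -(drop_size_cat s (erefl (size f))) catE szE.
  exact: drop_size_cat.
- by move=> x z f s _ _ _ _ _ /rcons_inj[].
- move=> ts ok_ts; case/lastP: ts ok_ts => // z [w ch].
  rewrite all_rcons => /andP[ok_t ok_z] _; case: w ch ok_t => [k|] [|t ch] //.
    set s := t :: ch; move=> /= /andP[/andP[k_gt0 le_k] ok_s]; right.
    have szk : size (take k s) = k by rewrite size_takel.
    have [] : all non_root_weighted (take k s) /\ all non_root_weighted (drop k s).
      by apply/andP; rewrite -all_cat cat_take_drop.
    exists z, (take k s), (drop k s); split=> //; first by rewrite -size_gt0 szk.
    by rewrite szk cat_take_drop.
  by left; exists z.
Qed.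

(** * Permutations *)

Definition is_perm (s : seq nat) : bool := uniq s && all (ltn^~ (size s)) s.

(** The patterns 2341, 2431 and 3241 are exactly the orders of four entries
[a, b, c, d] with [d] below [a] and [b], and [a] below [c]: then [d < c] as
well, and [b] can be anywhere relative to [a] and [c]. *)
Definition avoids_ends_low (s : seq nat) : Prop :=
  forall a b c d : nat, subseq [:: a; b; c; d] s -> ~~ [&& d < a, d < b & a < c].

Definition good_perms : set (seq nat) := [set s | is_perm s /\ avoids_ends_low s].

Lemma is_perm_iota s : is_perm s = perm_eq s (iota 0 (size s)).
Proof.
apply/andP/idP => [[s_uniq s_lt]|s_iota]; last first.
  rewrite (perm_uniq s_iota) iota_uniq (perm_all _ s_iota); split=> //.
  by apply/allP=> x; rewrite mem_iota.
apply: uniq_perm => //; first exact: iota_uniq.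
apply: (uniq_min_size s_uniq _ _).2; last by rewrite size_iota.
by move=> x /(allP s_lt); rewrite mem_iota.
Qed.

Lemma count_lt_perm s v : is_perm s -> v <= size s -> count (ltn^~ v) s = v.
Proof.
rewrite is_perm_iota => /seq.permP -> le_v; rewrite -(subnKC le_v) iotaD count_cat.
rewrite (@eq_in_count _ _ predT) ?count_predT ?size_iota => [|x]; last first.
  by rewrite mem_iota.
rewrite (@eq_in_count _ _ pred0) ?count_pred0 ?addn0 // => x.
by rewrite mem_iota add0n => /andP[+ _]; rewrite leqNgt => /negPf.
Qed.

Lemma avoids_ends_low_subseq s t :
  subseq s t -> avoids_ends_low t -> avoids_ends_low s.
Proof. by move=> st avoid a b c d sub; apply/avoid/(subseq_trans sub). Qed.

Lemma avoids_ends_low_map (g : nat -> nat) s : {mono g : x y / x < y} ->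
  avoids_ends_low (map g s) <-> avoids_ends_low s.
Proof.
move=> g_mono; split=> avoid a b c d sub.
  have := avoid (g a) (g b) (g c) (g d); rewrite !g_mono; apply.
  by rewrite -[[:: g a; _; _; _]]/(map g [:: a; b; c; d]) map_subseq.
have [m szm tE] := subseqP sub.
rewrite -map_mask in tE; set t := mask m s in tE.
have : subseq t s by exact: mask_subseq.
case: t tE => [|a' [|b' [|c' [|d' [|]]]]] //= [-> -> -> ->].
by rewrite !g_mono; apply: avoid.
Qed.

(** Moves the values from [k] on up by [r] to make room for [r] new values. *)
Definition lift_from (k r v : nat) : nat := if v < k then v else v + r.

Lemma lift_from_mono k r : {mono lift_from k r : x y / x < y}.
Proof. by move=> x y; rewrite /lift_from; case: ifP; case: ifP; lia. Qed.

Lemma lift_from_inj k r : injective (lift_from k r).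
Proof. by move=> x y; rewrite /lift_from; case: ifP; case: ifP; lia. Qed.

Definition unary_perm (s : seq nat) : seq nat := size s :: s.

(** Below the maximum, the values are arranged as: [f] without its maximum, then
[s], then the maximum of [f], then [z]. *)
Definition ternary_perm (z f s : seq nat) : seq nat :=
  let k := (size f).-1 in
  map (lift_from k (size s)) f ++ (size f + size s + size z) ::
    map (addn k) s ++ map (addn (size f + size s)) z.

Lemma unary_perm_good s : good_perms s -> good_perms (unary_perm s).
Proof.
case=> /andP[s_uniq s_lt] avoid; split.
  rewrite /is_perm /= s_uniq ltnSn andbT /=; apply/andP; split.
    by apply/negP => /(allP s_lt) /=; rewrite ltnn.
  by apply: sub_all s_lt => x /= /ltnW.
move=> a b c d; rewrite /unary_perm /=; case: eqP => [->|_]; last exact: avoid.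
move=> /mem_subseq sub; have /(allP s_lt) /= : c \in s.
  by apply: sub; rewrite !inE eqxx orbT.
by rewrite ltnNge => /negP cs; apply/negP => /and3P[_ _ /ltnW].
Qed.

Lemma size_ternary_perm z f s :
  size (ternary_perm z f s) = (size z + size f + size s).+1.
Proof. by rewrite /ternary_perm size_cat /= size_cat !size_map; lia. Qed.

Section TernaryPerm.

Variables z f s : seq nat.
Hypotheses (gz : good_perms z) (gf : good_perms f) (gs : good_perms s).
Hypothesis f_gt0 : 0 < size f.

Let k := (size f).-1.
Let M := k + size s.

Let mem_lower (x : nat) : x \in map (lift_from k (size s)) f -> x < k \/ x = M.
Proof.
case/mapP => v; have [/andP[_ f_lt] _] := gf; move/(allP f_lt) => /= v_lt ->.
by rewrite /lift_from /M /k; case: ifP; lia.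
Qed.

Let mem_middle (x : nat) : x \in map (addn k) s -> k <= x < M.
Proof.
by case/mapP => v; have [/andP[_ s_lt] _] := gs; move/(allP s_lt) => /= ? ->; rewrite /M; lia.
Qed.

Let mem_upper (x : nat) :
  x \in map (addn (size f + size s)) z -> M < x < size f + size s + size z.
Proof.
case/mapP => v; have [/andP[_ z_lt] _] := gz; move/(allP z_lt) => /= ? ->.
by rewrite /M /k; lia.
Qed.

Lemma is_perm_ternary : is_perm (ternary_perm z f s).
Proof.
have [/andP[z_uniq _] _] := gz; have [/andP[f_uniq _] _] := gf.
have [/andP[s_uniq _] _] := gs.
apply/andP; split.
  rewrite /ternary_perm cat_uniq /= cat_uniq map_inj_uniq ?f_uniq /=; last exact: lift_from_inj.
  rewrite !map_inj_uniq ?z_uniq ?s_uniq ?andbT /=; try exact: addnI.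
  apply/and3P; split.
  - rewrite negb_or; apply/andP; split; first by apply/negP => /mem_lower; rewrite /M /k; lia.
    apply/hasPn => x; rewrite mem_cat => /orP[/mem_middle|/mem_upper] x_in;
      by apply/negP => /mem_lower; lia.
  - rewrite mem_cat negb_or; apply/andP; split; apply/negP.
      by move=> /mem_middle; rewrite /M /k; lia.
    by move=> /mem_upper; lia.
  - apply/hasPn => x /mem_upper x_in; apply/negP => /mem_middle; lia.
apply/allP => x; rewrite size_ternary_perm /ternary_perm mem_cat in_cons mem_cat /=.
case/or4P => [/mem_lower|/eqP->|/mem_middle|/mem_upper]; rewrite /M /k; lia.
Qed.

(** An occurrence [a, b, c, d] inside one of the three parts is excluded by
assumption.  The entries after the part [L] of [f] exceed all of [L] except its
maximum [M], and [d] is smaller than [a] and [b], so at most [a] is in [L], and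
then [a = M].  In this case [d] is in the part of [s], while [c] exceeds [M] and
is not the overall maximum, being preceded by [b]; so [c] is in the part of [z],
which comes after [d].  If [a] is not in [L], it is not the overall maximum
either, and [d < a] puts the whole occurrence into the part of [s] or of [z]. *)
Lemma ternary_perm_avoids : avoids_ends_low (ternary_perm z f s).
Proof.
have := is_perm_ternary; rewrite /is_perm /ternary_perm => /andP[+ _].
rewrite -/k; set L := map _ f; set N := (_ + size z); set R1 := map _ s; set R2 := map _ z.
move=> p_uniq; have L_uniq : uniq L by move: p_uniq; rewrite cat_uniq => /and3P[].
have memR (x : nat) : x \in N :: R1 ++ R2 -> k <= x <= N.
  by rewrite in_cons mem_cat => /or3P[/eqP->|/mem_middle|/mem_upper]; rewrite /N /M /k; lia.
have LM (x : nat) : x \in L -> x <= M by move=> /mem_lower; rewrite /M; lia.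
have avoidL : avoids_ends_low L by apply/(avoids_ends_low_map _ (lift_from_mono _ _)); case: gf.
have avoid1 : avoids_ends_low R1.
  by apply/(avoids_ends_low_map _ (ltn_add2l _)); case: gs.
have avoid2 : avoids_ends_low R2.
  by apply/(avoids_ends_low_map _ (ltn_add2l _)); case: gz.
move=> a b c d /subseq_cat_inv[t1 [t2 [tE sub1 sub2]]].
apply/negP => /and3P[da db ac].
have mem1 := mem_subseq sub1; have mem2 := mem_subseq sub2.
case: t1 tE sub1 mem1 => [|a1 [|b1 [|c1 [|d1 [|]]]]] //= tE sub1 mem1.
- rewrite -{}tE in sub2 mem2.
  have aN : a != N by have := memR c (mem2 c _); rewrite !inE eqxx !orbT => /(_ isT); lia.
  rewrite /= (negPf aN) in sub2.
  have [u1 [u2 [uE sub3 sub4]]] := subseq_cat_inv sub2.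
  have mem3 := mem_subseq sub3; have mem4 := mem_subseq sub4.
  case: u2 uE sub4 mem4 => [|e u2] uE sub4 mem4.
    rewrite cats0 in uE; rewrite -uE in sub3.
    by have := avoid1 _ _ _ _ sub3; rewrite da db ac.
  case: u1 uE sub3 mem3 => [|e' u1] uE sub3 mem3.
    rewrite -[e :: u2]uE in sub4.
    by have := avoid2 _ _ _ _ sub4; rewrite da db ac.
  have aR1 : a \in R1 by apply: mem3; case: uE => ->; rewrite mem_head.
  have dR2 : d \in R2.
    apply: mem4; have -> : d = last e u2 by have := congr1 (last 0) uE; rewrite last_cat.
    exact: mem_last.
  by have := mem_middle aR1; have := mem_upper dR2; lia.
- case: tE => aE t2E; rewrite -{}aE -{}t2E in sub1 mem1 sub2 mem2.
  have aL : a \in L by apply: mem1; rewrite mem_head.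
  have /andP[kd _] : k <= d <= N by apply/memR/mem2; rewrite !inE eqxx ?orbT.
  have aM : a = M by have := mem_lower aL; lia.
  have sub_cd : subseq [:: c; d] (R1 ++ R2).
    by move: sub2 => /=; case: eqP => _ sub2; first exact: sub2;
      apply: subseq_trans sub2; apply: subseq_cons.
  have [[|x u1] [u2 [uE sub3 sub4]]] := subseq_cat_inv sub_cd.
    have mem4 := mem_subseq sub4; rewrite /= in uE.
    by have := mem_upper (mem4 d _); rewrite -uE !inE eqxx orbT => /(_ isT); lia.
  have mem3 := mem_subseq sub3; case: uE => cE _.
  by have := mem_middle (mem3 c _); rewrite cE mem_head => /(_ isT); lia.
- case: tE => aE bE t2E; rewrite -{}aE -{}bE -{}t2E in sub1 mem1 sub2 mem2.
  have /mem_lower aL : a \in L by apply: mem1; rewrite mem_head.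
  have /mem_lower bL : b \in L by apply: mem1; rewrite !inE eqxx orbT.
  have /andP[kd _] : k <= d <= N by apply/memR/mem2; rewrite !inE eqxx ?orbT.
  have : uniq [:: a; b] by apply: subseq_uniq sub1 L_uniq.
  by rewrite /= inE andbT; lia.
- case: tE => aE bE cE t2E; rewrite -{}aE -{}bE -{}cE -{}t2E in sub1 mem1 sub2 mem2.
  have /mem_lower aL : a \in L by apply: mem1; rewrite mem_head.
  have /LM cL : c \in L by apply: mem1; rewrite !inE eqxx !orbT.
  have /andP[kd _] : k <= d <= N by apply/memR/mem2; rewrite !inE eqxx ?orbT.
  by lia.
- case: tE => aE bE cE dE _; rewrite -{}aE -{}bE -{}cE -{}dE in sub1.
  by have := avoidL _ _ _ _ sub1; rewrite da db ac.
Qed.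

End TernaryPerm.

Lemma split_unique (x : nat) (s1 s2 t1 t2 : seq nat) :
  s1 ++ x :: s2 = t1 ++ x :: t2 -> x \notin s1 -> x \notin t1 -> s1 = t1 /\ s2 = t2.
Proof.
elim: s1 t1 => [|y s1 IH] [|z t1] /=.
- by case=> ->.
- by case=> -> _ _; rewrite mem_head.
- by case=> -> _; rewrite mem_head.
- by case=> <- /IH{}IH; rewrite !in_cons !negb_or => /andP[_ /IH h] /andP[_ /h[-> ->]].
Qed.

Lemma lift_from_le k r f : is_perm f -> 0 < size f -> k = (size f).-1 ->
  forall x : nat, x \in map (lift_from k r) f -> x <= k + r.
Proof.
move=> /andP[_ f_lt] f_gt0 -> _ /mapP[v /(allP f_lt) /= v_lt ->].
by rewrite /lift_from; case: ifP; lia.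
Qed.

Lemma lift_from_top k r f : is_perm f -> 0 < size f -> k = (size f).-1 ->
  k + r \in map (lift_from k r) f.
Proof.
move=> f_perm f_gt0 ->; apply/mapP; exists (size f).-1.
  by rewrite is_perm_iota in f_perm; rewrite (perm_mem f_perm) mem_iota add0n; lia.
by rewrite /lift_from ltnn.
Qed.

(** The position of the maximum separates the part of [f]; the largest entry
before it is [(size f).-1 + size s], which yields the size of [s]. *)
Lemma ternary_perm_inj z f s z' f' s' :
  good_perms z -> good_perms f -> good_perms s -> 0 < size f ->
  good_perms z' -> good_perms f' -> good_perms s' -> 0 < size f' ->
  ternary_perm z f s = ternary_perm z' f' s' -> [/\ z = z', f = f' & s = s'].
Proof.
move=> [_ _] [f_perm _] _ f_gt0 _ [f'_perm _] _ f'_gt0 eqE.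
have szE := congr1 size eqE; rewrite !size_ternary_perm in szE; move: eqE.
rewrite /ternary_perm; set k := _.-1; set k' := _.-1.
have leL := lift_from_le f_perm f_gt0 (erefl k).
have leL' := lift_from_le f'_perm f'_gt0 (erefl k').
have -> : size f' + size s' + size z' = size f + size s + size z by lia.
case/split_unique.
- by apply/negP => /leL; rewrite /k; lia.
- by apply/negP => /leL'; rewrite /k'; lia.
move=> fE tE; have szf : size f = size f'.
  by have := congr1 size fE; rewrite !size_map.
have kE : k' = k by rewrite /k' -szf.
have szs : size s = size s'.
  have := lift_from_top (size s) f_perm f_gt0 (erefl k); rewrite fE => /leL'.
  have := lift_from_top (size s') f'_perm f'_gt0 (erefl k'); rewrite -fE => /leL.
  by rewrite kE; lia.
move: fE tE; rewrite kE -szf -szs => /(inj_map (@lift_from_inj _ _)) -> /eqP.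
rewrite eqseq_cat ?size_map -?szs // => /andP[/eqP sE /eqP zE].
by split=> //; [exact: (inj_map (@addnI _) zE) | exact: (inj_map (@addnI _) sE)].
Qed.

Lemma unary_ternary_perm x z f s :
  good_perms z -> good_perms f -> good_perms s -> 0 < size f ->
  unary_perm x <> ternary_perm z f s.
Proof.
move=> gz [f_perm _] gs f_gt0 eqE.
have szE := congr1 size eqE; rewrite size_ternary_perm /= in szE.
move: eqE; rewrite /ternary_perm /unary_perm.
have leL := lift_from_le f_perm f_gt0 (erefl (size f).-1).
case: (map _ f) (leL (size s)) (size_map (lift_from (size f).-1 (size s)) f) => [|y L] le_y.
  by move=> /= f0; rewrite -f0 in f_gt0.
by move=> _ [yE _]; have := le_y y (mem_head _ _); rewrite -yE; lia.
Qed.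

Definition lower_from (k r v : nat) : nat := if v < k then v else v - r.

Lemma filter_lt_gt (m : nat) s :
  m \notin s -> (forall u w : nat, subseq [:: u; w] s -> w < m -> u < m) ->
  s = filter (ltn^~ m) s ++ filter (ltn m) s.
Proof.
elim: s => //= x s IH; rewrite in_cons negb_or => /andP[mx ms] before.
have sE : s = filter (ltn^~ m) s ++ filter (ltn m) s.
  apply: IH => // u w sub; apply: before.
  by case: ifP => // _; apply: subseq_trans sub; apply: subseq_cons.
have [xm|] := ltnP x m; first by rewrite ltnNge (ltnW xm) /= {1}sE.
rewrite leq_eqVlt (negPf mx) /= => lt_mx; rewrite lt_mx.
have lt0 : filter (ltn^~ m) s = [::].
  apply/eqP; rewrite -size_eq0 size_filter -leqn0 leqNgt -has_count.
  apply/hasPn => w ws; rewrite /= -leqNgt leqNgt; apply/negP => wm.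
  by have := before x w; rewrite eqxx sub1seq => /(_ ws wm); lia.
by rewrite lt0 /= {1}sE lt0.
Qed.

(** Write the permutation as [L ++ n :: R] with [n] its maximum, and let [M] be
the maximum of [L].  If another entry [x] of [L] exceeded an entry [u] of [R],
then [x], [M], [n], [u] would be forbidden whatever the order of [x] and [M]; if
an entry [u > M] of [R] preceded an entry [w < M], then [M], [n], [u], [w] would
be.  The values are then determined by counting smaller entries. *)
Lemma good_perm_cover y : good_perms y -> 0 < size y ->
  (exists2 z, good_perms z & unary_perm z = y) \/
  exists z f s, [/\ good_perms z, good_perms f, good_perms s, 0 < size f
                  & ternary_perm z f s = y].
Proof.
case=> y_perm avoid y_gt0; have [y_uniq y_lt] := andP y_perm.
set n := (size y).-1.
have ny : n \in y by move: (y_perm); rewrite is_perm_iota => /perm_mem ->; rewrite mem_iota /n; lia.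
have [L [R yE]] : exists L R, y = L ++ n :: R.
  by case/splitPr: ny => L R; exists L, R.
have szy : size L + size R = n by rewrite /n yE size_cat /= addnS.
have szyE : size y = n.+1 by rewrite /n prednK.
have n_notin : n \notin L ++ R.
  by move: y_uniq; rewrite yE -[n :: R]cat1s uniq_catCA /= => /andP[].
have lt_n x : x \in L ++ R -> x < n.
  move=> xLR; have : x \in y by move: xLR; rewrite yE !mem_cat in_cons orbCA => ->; rewrite orbT.
  move/(allP y_lt); rewrite /= szyE ltnS leq_eqVlt => /predU1P[xn|//].
  by rewrite -xn xLR in n_notin.
have good_part t : subseq t y -> uniq t /\ avoids_ends_low t.
  by move=> sub; split; [exact: subseq_uniq y_uniq | exact: avoids_ends_low_subseq avoid].
have [uniqL avoidL] := good_part L (ltac:(by rewrite yE prefix_subseq)).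
have subR : subseq R y by rewrite yE -cat_rcons suffix_subseq.
have [uniqR avoidR] := good_part R subR.
case: (posnP (size L)) => [/size0nil L0|L_gt0].
  left; exists R; last by rewrite /unary_perm yE L0 -szy L0.
  split=> //; rewrite /is_perm uniqR; apply/allP => x xR /=.
  by have := lt_n x; rewrite L0 -szy L0 => /(_ xR).
right.
have disj x : x \in L -> x \notin R.
  move=> xL; apply/negP => xR; move: y_uniq; rewrite yE cat_uniq => /and3P[_ /hasPn + _].
  by move/(_ x); rewrite in_cons xR orbT xL => /(_ isT).
have [|e1 [M [e2 [LE le1 lt2]]]] := @last_max_exists L; first by rewrite -size_eq0 -lt0n.
have ML : M \in L by rewrite LE mem_cat mem_head orbT.
have leM x : x \in L -> x <= M.
  by rewrite LE mem_cat in_cons => /or3P[/(allP le1)//|/eqP->//|/(allP lt2)/ltnW].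
pose k := (size L).-1; pose L' := rem M L.
have szL' : size L' = k by rewrite size_rem.
have L'P x : (x \in L') = (x != M) && (x \in L) by rewrite mem_rem_uniq.
have LL' : perm_eq L (M :: L') by apply: perm_to_rem.
have low_lt x u : x \in L' -> u \in R -> x < u.
  rewrite L'P => /andP[xM xL] uR; rewrite ltnNge leq_eqVlt; apply/negP => /predU1P[ux|ux].
    by move/negP: (disj x xL); rewrite -ux.
  have lexM := leM x xL.
  have sub2 : subseq [:: n; u] (n :: R) by rewrite /= eqxx sub1seq.
  have [xn Mn] : x < n /\ M < n by split; apply: lt_n; rewrite mem_cat ?xL ?ML.
  have : subseq [:: x; M] L \/ subseq [:: M; x] L.
    move: xL; rewrite LE mem_cat in_cons (negPf xM) /= => /orP[x1|x2]; [left|right].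
      by rewrite -[[:: x; M]]/([:: x] ++ [:: M]) cat_subseq ?sub1seq ?mem_head.
    by rewrite -[[:: M; x]]/([::] ++ [:: M; x]) cat_subseq ?sub0seq //= eqxx sub1seq.
  case=> sub1; have := cat_subseq sub1 sub2; rewrite -yE => /avoid.
    by rewrite ux xn (leq_trans ux lexM).
  by rewrite ux Mn (leq_trans ux lexM).
have before u w : subseq [:: u; w] R -> w < M -> u < M.
  move=> sub wM; rewrite ltnNge leq_eqVlt; apply/negP => /predU1P[Mu|Mu].
    by move/negP: (disj M ML); apply; rewrite Mu; apply: (mem_subseq sub); rewrite mem_head.
  have sub1 : subseq [:: M] L by rewrite sub1seq.
  have sub2 : subseq [:: n; u; w] (n :: R) by rewrite /= eqxx.
  have Mn : M < n by apply: lt_n; rewrite mem_cat ML.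
  have := cat_subseq sub1 sub2; rewrite -yE => /avoid.
  by rewrite wM Mu (ltn_trans wM Mn).
have RE := filter_lt_gt (disj M ML) before.
set R1 := filter _ R in RE; set R2 := filter _ R in RE.
have rank x : x < n -> x = (x > M) + count (ltn^~ x) L' + count (ltn^~ x) R.
  move=> xn; rewrite -[LHS](count_lt_perm y_perm) ?szyE ?(leqW (ltnW xn)) //.
  by rewrite yE count_cat /= (seq.permP LL') /= [n < x]ltnNge (ltnW xn).
(* No entry of [R] is smaller than [x], and among the entries of [L] neither [x]
   nor [M] is. *)
have low x : x \in L' -> x < k.
  move=> xL'; have /andP[xM xL] : (x != M) && (x \in L) by rewrite -L'P.
  have xn : x < n by apply: lt_n; rewrite mem_cat xL.
  rewrite (rank x xn) [M < x]ltnNge (leM x xL) add0n -szL'.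
  have -> : count (ltn^~ x) R = 0.
    apply/eqP; rewrite -leqn0 leqNgt -has_count; apply/hasPn => u uR.
    by rewrite /= -leqNgt ltnW // low_lt.
  rewrite addn0 ltn_neqAle count_size andbT -all_count; apply/allPn; exists x => //.
  by rewrite /= ltnn.
have ME : M = k + size R1.
  have Mn : M < n by apply: lt_n; rewrite mem_cat ML.
  rewrite [LHS](rank M Mn) ltnn add0n size_filter -szL'; congr (_ + _).
  apply/eqP; rewrite -all_count; apply/allP => x; rewrite L'P => /andP[xM xL] /=.
  by rewrite ltn_neqAle xM leM.
have middle x : x \in R1 -> k <= x < M.
  rewrite mem_filter => /andP[/= xM xR]; rewrite xM andbT.
  have xn : x < n by apply: lt_n; rewrite mem_cat xR orbT.
  rewrite [X in _ <= X](rank x xn) -szL'.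
  suff -> : count (ltn^~ x) L' = size L' by rewrite -addnA addnCA leq_addr.
  by apply/eqP; rewrite -all_count; apply/allP => u /low_lt; apply.
have upper x : x \in R2 -> M < x < n.
  by rewrite mem_filter => /andP[/= -> xR]; apply: lt_n; rewrite mem_cat xR orbT.
have szR : size R = size R1 + size R2 by rewrite {1}RE size_cat.
have fK : map (lift_from k (size R1)) (map (lower_from k (size R1)) L) = L.
  rewrite -map_comp map_id_in // => x xL /=; rewrite /lift_from /lower_from.
  have [->|xM] := eqVneq x M; last by rewrite low ?low // L'P xM.
  by rewrite ME [k + _ < k]ltnNge leq_addr /= addnK ltnn.
have sK : map (addn k) (map (subn^~ k) R1) = R1.
  by rewrite -map_comp map_id_in // => x /middle /andP[kx _] /=; rewrite subnKC.
have szLE : size L = k.+1 by rewrite /k prednK.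
have zK : map (addn (size L + size R1)) (map (subn^~ (size L + size R1)) R2) = R2.
  by rewrite -map_comp map_id_in // => x /upper /andP[Mx _] /=;
    rewrite subnKC // szLE addSn -ME.
have R1_sub : subseq R1 R by apply: filter_subseq.
have R2_sub : subseq R2 R by apply: filter_subseq.
exists (map (subn^~ (size L + size R1)) R2),
  (map (lower_from k (size R1)) L), (map (subn^~ k) R1).
split.
- split; last first.
    apply/(avoids_ends_low_map _ (ltn_add2l (size L + size R1))); rewrite zK.
    exact: avoids_ends_low_subseq avoidR.
  apply/andP; split.
    by rewrite -(map_inj_uniq (@addnI (size L + size R1))) zK; apply: subseq_uniq uniqR.
  by apply/allP => _ /mapP[x /upper/andP[Mx xn] ->] /=; rewrite size_map;
    clear -xn Mx szy szR ME szLE; lia.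
- split; last by apply/(avoids_ends_low_map _ (lift_from_mono k (size R1))); rewrite fK.
  apply/andP; split; first by rewrite -(map_inj_uniq (@lift_from_inj k (size R1))) fK.
  apply/allP => _ /mapP[x xL ->] /=; rewrite size_map /lower_from.
  by have := leM x xL; rewrite ME szLE; case: ifP; clear; lia.
- split; last first.
    apply/(avoids_ends_low_map _ (ltn_add2l k)); rewrite sK.
    exact: avoids_ends_low_subseq avoidR.
  apply/andP; split.
    by rewrite -(map_inj_uniq (@addnI k)) sK; apply: subseq_uniq uniqR.
  by apply/allP => _ /mapP[x /middle xb ->] /=; rewrite size_map; clear -xb ME; lia.
- by rewrite size_map.
- rewrite /ternary_perm !size_map fK sK zK yE [in RHS]RE; congr (_ ++ _ :: _).
  by rewrite -addnA -szR.
Qed.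

Lemma shapes_good_perms n :
  equipotent (set_type (shapes n))
             (set_type [set s | good_perms s /\ size s = n]%classic).
Proof.
apply: (@shapes_decomposition _ good_perms size [::] unary_perm ternary_perm) => //.
- by move=> s _ /size0nil.
- by move=> s gs; split=> //; apply: unary_perm_good.
- move=> z f s gz gf gs f_gt0; split; last exact: size_ternary_perm.
  by split; [apply: is_perm_ternary | apply: ternary_perm_avoids].
- by move=> s t _ _ [].
- exact: ternary_perm_inj.
- by move=> x z f s _; apply: unary_ternary_perm.
- exact: good_perm_cover.
Qed.

Lemma quadruple_subseqP (s : seq nat) (a b c d : nat) :
  subseq [:: a; b; c; d] s <->
  exists i j k l, [/\ [&& i < j, j < k & k < l], l < size s,
    nth 0 s i = a /\ nth 0 s j = b, nth 0 s k = c & nth 0 s l = d].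
Proof.
split=> [|[i [j [k [l [/and3P[ij jk kl] lt_l [<- <-] <- <-]]]]]].
  move/subseq_consP => [i [lt_i aE]] /triple_subseqP[j [k [l [jkl]]]].
  rewrite size_drop !nth_drop => lt_l bE cE dE.
  by exists i, (i.+1 + j), (i.+1 + k), (i.+1 + l); split=> //; lia.
apply/subseq_consP; exists i; split=> //; first by lia.
apply/triple_subseqP; exists (j - i.+1), (k - i.+1), (l - i.+1).
by rewrite size_drop !nth_drop !subnKC; try lia; split=> //; lia.
Qed.

Definition one_line (n : nat) (pi : 'S_n) : seq nat := [seq val (pi i) | i <- enum 'I_n].

Lemma size_one_line n (pi : 'S_n) : size (one_line pi) = n.
Proof. by rewrite size_map size_enum_ord. Qed.

Lemma nth_one_line n (pi : 'S_n) (i : 'I_n) : nth 0 (one_line pi) i = pi i.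
Proof. by rewrite (nth_map i) ?size_enum_ord // nth_ord_enum. Qed.

Lemma is_perm_one_line n (pi : 'S_n) : is_perm (one_line pi).
Proof.
rewrite /is_perm size_one_line map_inj_uniq ?enum_uniq; last first.
  by move=> i j /val_inj/perm_inj.
by apply/allP => _ /mapP[i _ ->] /=.
Qed.

Lemma one_line_inj n : injective (@one_line n).
Proof.
by move=> pi rho E; apply/permP => i; apply/val_inj; rewrite /= -!nth_one_line E.
Qed.

Lemma one_line_surj n s : is_perm s -> size s = n -> exists pi : 'S_n, one_line pi = s.
Proof.
move=> /andP[s_uniq s_lt] sz.
have lt_n (i : 'I_n) : nth 0 s i < n.
  by rewrite -[X in _ < X]sz; apply: (allP s_lt); rewrite mem_nth ?sz.
pose f i := Ordinal (lt_n i).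
have f_inj : injective f.
  by move=> i j [] /eqP; rewrite nth_uniq ?sz // => /eqP/val_inj.
exists (perm f_inj); apply: (@eq_from_nth _ 0); rewrite size_one_line // => i lt_i.
by rewrite -[i]/(val (Ordinal lt_i)) nth_one_line permE.
Qed.

Lemma contains_pattern4 n (pi : 'S_n) (sigma v : seq nat) (i j k l : 'I_n) :
    size sigma = 4 -> i < j -> j < k -> k < l ->
    v = [:: pi i : nat; pi j : nat; pi k : nat; pi l : nat] ->
    all (fun a => all (fun b =>
      (nth 0 v a < nth 0 v b) == (nth 0 sigma a < nth 0 sigma b))
      (iota 0 4)) (iota 0 4) ->
  contains_pattern pi sigma.
Proof.
case: sigma => [|s0 [|s1 [|s2 [|s3 [|]]]]] // _ ij jk kl vE /allP orderE.
exists (fun x => nth i [:: i; j; k; l] x); split.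
  by case=> [[|[|[|[|//]]]] ?] [[|[|[|[|//]]]] ?] //= _; lia.
move=> a b; have := orderE a; rewrite mem_iota => /(_ (ltn_ord a)) /allP /(_ b).
rewrite mem_iota => /(_ (ltn_ord b)) /eqP <-; rewrite vE.
by case: a b => [[|[|[|[|//]]]] ?] [[|[|[|[|//]]]] ?].
Qed.

Definition patterns : seq (seq nat) := [:: [:: 2; 3; 4; 1]; [:: 2; 4; 3; 1]; [:: 3; 2; 4; 1]].

Lemma avoiding_permsP n (pi : 'S_n) :
  avoiding_perms n patterns pi <-> avoids_ends_low (one_line pi).
Proof.
split=> avoid.
  move=> a b c d /quadruple_subseqP[i [j [k [l [/and3P[ij jk kl]]]]]].
  rewrite size_one_line => lt_l.
  have [lt_k lt_j lt_i] : [/\ k < n, j < n & i < n] by split; lia.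
  rewrite -[i]/(val (Ordinal lt_i)) -[j]/(val (Ordinal lt_j)) -[k]/(val (Ordinal lt_k)).
  rewrite -[l]/(val (Ordinal lt_l)) !nth_one_line => -[aE bE] cE dE.
  have neq_ab : a != b.
    by rewrite -aE -bE val_eqE (inj_eq perm_inj) -val_eqE /=; lia.
  have neq_bc : b != c.
    by rewrite -bE -cE val_eqE (inj_eq perm_inj) -val_eqE /=; lia.
  apply/negP => /and3P[da db ac].
  have occurs sigma := @contains_pattern4 n pi sigma [:: a; b; c; d]
    (Ordinal lt_i) (Ordinal lt_j) (Ordinal lt_k) (Ordinal lt_l).
  have vE : [:: a; b; c; d] = [:: pi (Ordinal lt_i) : nat; pi (Ordinal lt_j) : nat;
      pi (Ordinal lt_k) : nat; pi (Ordinal lt_l) : nat] by rewrite aE bE cE dE.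
  have [bc|cb|bc] := ltngtP b c; last by rewrite bc eqxx in neq_bc.
    have [ab|ba|ab] := ltngtP a b; last by rewrite ab eqxx in neq_ab.
      apply: (avoid [:: 2; 3; 4; 1]) => //; apply: occurs => //=.
      by clear -da db ac bc ab; lia.
    apply: (avoid [:: 3; 2; 4; 1]) => //; apply: occurs => //=.
    by clear -da db ac bc ba; lia.
  apply: (avoid [:: 2; 4; 3; 1]) => //; apply: occurs => //=.
  by clear -da db ac cb; lia.
move=> sigma sigma_in [f [f_mono f_order]].
have sz : size sigma = 4 by move: sigma_in; rewrite !inE => /or3P[] /eqP->.
have lt4 m : m < 4 -> m < size sigma by rewrite sz.
pose o m (lt_m : m < 4) := f (Ordinal (lt4 m lt_m)).
have /avoid/negP : subseq [:: pi (o 0 isT) : nat; pi (o 1 isT) : nat;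
    pi (o 2 isT) : nat; pi (o 3 isT) : nat] (one_line pi).
  apply/quadruple_subseqP.
  exists (o 0 isT), (o 1 isT), (o 2 isT), (o 3 isT).
  rewrite size_one_line !nth_one_line; split=> //.
  by rewrite !f_mono.
apply; apply/and3P; split; apply/f_order => /=;
  by move: sigma_in; rewrite !inE => /or3P[] /eqP->.
Qed.

Lemma good_perms_avoiding n :
  equipotent (set_type [set s | good_perms s /\ size s = n]%classic)
             (set_type (avoiding_perms n patterns)).
Proof.
apply: equipotent_sym; apply: (equipotent_sets (f := @one_line n)).
- move=> pi /avoiding_permsP avoid; split; last exact: size_one_line.
  by split; first exact: is_perm_one_line.
- by move=> pi rho _ _ /one_line_inj.
- move=> s [[s_perm avoid] sz]; have [pi piE] := one_line_surj s_perm sz.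
  by exists pi => //; apply/avoiding_permsP; rewrite piE.
Qed.

(** * Schröder paths without triple descents *)

(** The final height of the path starting at height [k], if it stays weakly above
the axis and uses only the three steps. *)
Fixpoint walk (k : nat) (s : seq (int * int)) : option nat :=
  if s is x :: s' then
    if x == step_u then walk k.+1 s'
    else if x == step_h then walk k s'
    else if x == step_d then (if k is k'.+1 then walk k' s' else None)
    else None
  else Some k.

Definition semilength (s : seq (int * int)) : nat := count (predC1 step_d) s.

Lemma walk_cat k s t : walk k (s ++ t) = obind (walk^~ t) (walk k s).
Proof.
elim: s k => //= x s IH k; case: ifP => _ //; case: ifP => _ //; case: ifP => _ //.
by case: k.
Qed.

Lemma walk_rise k j m s : walk k s = Some m -> walk (k + j) s = Some (m + j).
Proof.
elim: s k => [k [<-]|x s IH k] //=; case: ifP => _; first exact: (IH k.+1).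
case: ifP => _; first exact: IH.
by case: ifP => _ //; case: k => // k; exact: IH.
Qed.

Lemma walk_downs k j : walk k (nseq j step_d) = if j <= k then Some (k - j) else None.
Proof. by elim: j k => [|j IH] [|k] //=; rewrite ?IH ?subn0 ?subSS. Qed.

Lemma height_take_cons i x s :
  ((path_end (take i.+1 (x :: s))).2 = x.2 + (path_end (take i s)).2)%R.
Proof. by rewrite -[take _ _]/(x :: take i s) path_end_cons. Qed.

Lemma walkP (k : nat) s m :
  walk k s = Some m <->
  [/\ forall p : int * int, p \in s -> p \in [:: step_u; step_d; step_h],
      (k%:Z + (path_end s).2 = m%:Z)%R
    & forall i, i <= size s -> (0 <= k%:Z + (path_end (take i s)).2)%R].
Proof.
elim: s k => [|x s IH] k.
  rewrite path_end_nil; split=> [[<-]|[_ kE _]].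
    by split; [| rewrite GRing.addr0 | move=> i _ /=; lia].
  by congr Some; move: kE => /=; lia.
rewrite /= path_end_cons; split=> [|[steps endE nn]].
  have step (y : int * int) k' : y \in [:: step_u; step_d; step_h] ->
      (k%:Z + y.2 = k'%:Z)%R -> walk k' s = Some m ->
    [/\ forall p : int * int, p \in y :: s -> p \in [:: step_u; step_d; step_h],
      (k%:Z + (y + path_end s).2 = m%:Z)%R
      & forall i, i <= (size s).+1 -> (0 <= k%:Z + (path_end (take i (y :: s))).2)%R].
    move=> y_in kE /IH[steps endE nn]; split.
    - by move=> p; rewrite in_cons => /predU1P[->|/steps].
    - by move: endE kE => /=; lia.
    - case=> [|i lt_i]; first by rewrite path_end_nil /=; lia.
      by rewrite height_take_cons; have := nn i lt_i; lia.
  case: eqP => [->|_]; first by apply: step => //=; lia.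
  case: eqP => [->|_]; first by apply: step => //=; lia.
  by case: eqP => [->|_] //; case: k step => // k step; apply: step => //=; lia.
have nn1 := nn 1 isT; rewrite height_take_cons take0 path_end_nil /= in nn1.
have step k' : (k%:Z + x.2 = k'%:Z)%R -> walk k' s = Some m.
  move=> kE; apply/IH; split.
  - by move=> p ps; apply: steps; rewrite in_cons ps orbT.
  - by move: endE kE => /=; lia.
  - by move=> i le_i; have := nn i.+1 le_i; rewrite height_take_cons; lia.
have := steps x (mem_head _ _); rewrite !inE => /or3P[]/eqP xE; rewrite xE in nn1 step *.
- by apply: step => /=; lia.
- by case: k nn1 step {IH endE nn} => [|k] //= _; apply; lia.
- by apply: step => /=; lia.
Qed.

Lemma path_end_semilength s :
    (forall p : int * int, p \in s -> p \in [:: step_u; step_d; step_h]) ->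
  ((path_end s).1 + (path_end s).2 = (2 * semilength s)%:Z)%R.
Proof.
elim: s => [|x s IH] steps; first by rewrite path_end_nil.
have {}IH : ((path_end s).1 + (path_end s).2 = (2 * semilength s)%:Z)%R.
  by apply: IH => p ps; apply: steps; rewrite in_cons ps orbT.
rewrite path_end_cons /semilength /= -/(semilength s).
by have := steps x (mem_head _ _); rewrite !inE => /or3P[]/eqP-> /=; lia.
Qed.

Lemma schroder_pathsP n s :
  schroder_paths n s <-> walk 0 s = Some 0 /\ semilength s = n.
Proof.
rewrite walkP; split=> [[steps endE nn]|[[steps endE nn] sz]].
  have := path_end_semilength steps; rewrite endE /= => szE.
  split; last by lia.
  by split; rewrite ?endE // => i /nn; rewrite GRing.add0r.
split=> //; last by move=> i le_i; have := nn i le_i; rewrite GRing.add0r.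
have := path_end_semilength steps; rewrite sz; move: endE.
by case: (path_end s) => a b /= *; congr pair; lia.
Qed.

Definition ddd : seq (int * int) := [:: step_d; step_d; step_d].

Lemma infix_ddd_cat (x : int * int) (s t : seq (int * int)) : x != step_d ->
  infix ddd (s ++ x :: t) = infix ddd s || infix ddd t.
Proof.
move=> /negPf xd; elim: s => [|y s IH].
  by rewrite /= eq_sym xd.
rewrite /= IH; rewrite orbA; congr (_ || _); congr (_ || _).
case: s {IH} => [|y1 [|y2 s]] /=; by rewrite ?(eq_sym _ x) ?xd ?andbF ?prefix0s.
Qed.

Definition no_ddd_path (s : seq (int * int)) : Prop :=
  walk 0 s = Some 0 /\ ~~ infix ddd s.

(** The prefix [p] ends where the path leaves the axis for the last time. *)
Lemma last_passage w m : walk 0 w = Some m.+1 ->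
  exists p w', [/\ w = p ++ step_u :: w', walk 0 p = Some 0 & walk 0 w' = Some m].
Proof.
elim/last_ind: w m => // w x IH m; rewrite -cats1 walk_cat.
case wE: (walk 0 w) => [j|] //=.
case: eqP => [-> [jm]|_].
  case: m jm => [|m] jm; first by exists w, [::]; rewrite wE jm.
  have [|p [w' [-> p0 w'm]]] := IH m; first by rewrite wE jm.
  by exists p, (rcons w' step_u); rewrite -catA cat_cons cats1 -cats1 walk_cat w'm.
case: eqP => [-> [jm]|_].
  have [|p [w' [-> p0 w'm]]] := IH m; first by rewrite wE jm.
  by exists p, (rcons w' step_h); rewrite -catA cat_cons cats1 -cats1 walk_cat w'm.
case: eqP => [->|_] //; case: j wE => // j wE [jm].
have [|p [w' [-> p0 w'm]]] := IH m.+1; first by rewrite wE jm.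
by exists p, (rcons w' step_d); rewrite -catA cat_cons cats1 -cats1 walk_cat w'm.
Qed.

(** A longer prefix would contain the last up step from the axis and then stay
above it, so it could not end on the axis. *)
Lemma last_passage_unique p w q v m n :
  p ++ step_u :: w = q ++ step_u :: v ->
  walk 0 p = Some 0 -> walk 0 q = Some 0 -> walk 0 w = Some m -> walk 0 v = Some n ->
  p = q /\ w = v.
Proof.
have late s t (j : nat) : walk 0 s = Some 0 -> walk 0 t = Some j ->
    walk 0 (s ++ step_u :: t) <> Some 0.
  by move=> s0 tj; rewrite walk_cat s0 /= (walk_rise 1 tj) addn1.
wlog le_pq : p w q v m n / size p <= size q.
  move=> H E; case: (leqP (size p) (size q)) => [le_pq|/ltnW le_qp].
    exact: (H _ _ _ _ m n).
  by move=> p0 q0 wm vn; have [] := H _ _ _ _ n m le_qp (esym E) q0 p0 vn wm => -> ->.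
move=> E p0 q0 wm vn; have := congr1 (take (size p)) E.
rewrite take_size_cat // takel_cat // => pE.
have qE := cat_take_drop (size p) q; rewrite -pE in qE.
rewrite -qE -catA in E; move/eqP: E; rewrite eqseq_cat // eqxx /= => /eqP.
case dropE: (drop _ q) qE => [|x t] qE; first by case=> ->; rewrite -qE cats0.
case=> xE wE; rewrite wE walk_cat in wm.
case tE: (walk 0 t) wm => [j|] // _.
by case: (late p t j p0 tE); rewrite xE qE.
Qed.

Definition add_run (w : seq (int * int)) (x : int * int) (j : nat) : seq (int * int) :=
  w ++ x :: nseq j step_d.

Lemma add_run_unique w x j v y k : x != step_d -> y != step_d ->
  add_run w x j = add_run v y k -> [/\ w = v, x = y & j = k].
Proof.
move=> xd yd; elim: j k => [|j IH] [|k].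
- by rewrite /add_run !cats1 => /rcons_inj[-> ->].
- rewrite /add_run -[k.+1]addn1 nseqD -cat_cons catA !cats1 => /rcons_inj[_ xE].
  by rewrite xE eqxx in xd.
- rewrite /add_run -[j.+1]addn1 nseqD -cat_cons catA !cats1 => /rcons_inj[_ yE].
  by rewrite -yE eqxx in yd.
- rewrite /add_run -addn1 -[k.+1]addn1 !nseqD -!cat_cons !catA !cats1.
  by case/rcons_inj=> /IH[-> -> ->].
Qed.

Lemma add_run_nil w x j : add_run w x j <> [::].
Proof. by case: w. Qed.

Lemma add_run_exists k s : walk 0 s = Some k -> s != [::] ->
  exists w x j, [/\ s = add_run w x j & (x == step_u) || (x == step_h)].
Proof.
elim/last_ind: s k => // s y IH k; rewrite -cats1 walk_cat.
case sE: (walk 0 s) => [j|] //= yE _.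
have [yu|y_nu] := eqVneq y step_u; first by exists s, y, 0; rewrite /add_run yu.
have [yh|y_nh] := eqVneq y step_h; first by exists s, y, 0; rewrite /add_run yh.
rewrite (negPf y_nu) (negPf y_nh) in yE; case: eqP yE => // -> yE.
case: (eqVneq s [::]) sE => [->|s_n0] sE; first by case: sE yE => <-.
have [w [x [i [-> x_up]]]] := IH _ sE s_n0; exists w, x, i.+1; split=> //.
by rewrite /add_run -[i.+1]addn1 nseqD -cat_cons catA.
Qed.

Definition unary_path (z : option (seq (int * int))) :=
  if z is Some p then Some (add_run p step_h 0) else Some [::].

(** [None] is the empty forest, and a path of semilength [m] stands for a forest
with [m + 1] edges.  The six possibilities for a last tree after an empty or
nonempty forest match the ends of paths: nothing, [h], [ud], [udd], [hd] and
[hdd].  In front of [j] final down steps, the step [h] has to be reached by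
[j + 1] components and the step [u] by [j], so [u] serves for empty [z]. *)
Definition ternary_path (z f s : option (seq (int * int))) :=
  match z, f, s with
  | None, Some q, None => Some (add_run q step_u 1)
  | None, Some q, Some r => Some (add_run (q ++ step_u :: r) step_u 2)
  | Some p, Some q, None => Some (add_run (p ++ step_u :: q) step_h 1)
  | Some p, Some q, Some r =>
      Some (add_run (p ++ step_u :: q ++ step_u :: r) step_h 2)
  | _, None, _ => None
  end.

Definition optional_path : set (option (seq (int * int))) :=
  [set o | if o is Some p then no_ddd_path p else True].

Definition optional_size (o : option (seq (int * int))) : nat :=
  if o is Some p then (semilength p).+1 else 0.

Lemma no_ddd_add_run w x j m : walk 0 w = Some m -> ~~ infix ddd w ->
    (x == step_u) || (x == step_h) -> m + (x == step_u) = j -> j < 3 ->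
  no_ddd_path (add_run w x j).
Proof.
move=> wm no_ddd x_up jE lt_j3.
have xd : x != step_d by case/orP: x_up => /eqP->.
split; last first.
  rewrite infix_ddd_cat // negb_or no_ddd.
  by case: (j) lt_j3 => [|[|[]]].
rewrite walk_cat wm /= walk_downs walk_downs.
by case/orP: x_up jE => /eqP-> /= <-; rewrite ?addn1 ?addn0 leqnn subnn.
Qed.

Lemma no_ddd_glue p w m : no_ddd_path p -> walk 0 w = Some m -> ~~ infix ddd w ->
  walk 0 (p ++ step_u :: w) = Some m.+1 /\ ~~ infix ddd (p ++ step_u :: w).
Proof.
move=> [p0 p_ddd] wm w_ddd; split; last by rewrite infix_ddd_cat // negb_or p_ddd.
by rewrite walk_cat p0 /= (walk_rise 1 wm) addn1.
Qed.

Lemma semilength_glue p w :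
  semilength (p ++ step_u :: w) = (semilength p + semilength w).+1.
Proof. by rewrite /semilength count_cat /= addnS. Qed.

Lemma semilength_add_run w x j : x != step_d ->
  semilength (add_run w x j) = (semilength w).+1.
Proof.
by move=> xd; rewrite /semilength count_cat /= xd count_nseq /= addn1.
Qed.

Lemma no_ddd_unglue p w : ~~ infix ddd (p ++ step_u :: w) ->
  ~~ infix ddd p /\ ~~ infix ddd w.
Proof. by rewrite infix_ddd_cat // negb_or => /andP. Qed.

Lemma shapes_optional_paths n :
  equipotent (set_type (shapes n))
    (set_type [set o | optional_path o /\ optional_size o = n]%classic).
Proof.
apply: (@shapes_decomposition _ optional_path optional_size None
          unary_path ternary_path) => //.
- by case.
- case=> [p|] //= [p0 p_ddd]; split; first exact: no_ddd_add_run p0 _ _ _ _.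
  by rewrite semilength_add_run.
- case=> [p|] [q|] [r|] //= gp gq gr _.
  + have [qr_walk qr_ddd] := no_ddd_glue gq gr.1 gr.2.
    have [pqr_walk pqr_ddd] := no_ddd_glue gp qr_walk qr_ddd.
    split; first exact: no_ddd_add_run pqr_walk _ _ _ _.
    by rewrite semilength_add_run // !semilength_glue; lia.
  + have [pq_walk pq_ddd] := no_ddd_glue gp gq.1 gq.2.
    split; first exact: no_ddd_add_run pq_walk _ _ _ _.
    by rewrite semilength_add_run // !semilength_glue; lia.
  + have [qr_walk qr_ddd] := no_ddd_glue gq gr.1 gr.2.
    split; first exact: no_ddd_add_run qr_walk _ _ _ _.
    by rewrite semilength_add_run // !semilength_glue; lia.
  + split; first exact: no_ddd_add_run gq.1 gq.2 _ _ _.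
    by rewrite semilength_add_run // ?semilength_glue; lia.
- case=> [p|] [p'|] //= _ _ [].
  + by case/add_run_unique => // ->.
  + by move/add_run_nil.
  + by move=> nilE; case: (add_run_nil (esym nilE)).
- case=> [p|] [q|] [r|] //; case=> [p'|] [q'|] [r'|] //= gp gq gr _ gp' gq' gr' _ [];
    case/add_run_unique => // E _.
  + have [qr_walk qr_ddd] := no_ddd_glue gq gr.1 gr.2.
    have [qr'_walk qr'_ddd] := no_ddd_glue gq' gr'.1 gr'.2.
    have [-> {}E] := last_passage_unique E gp.1 gp'.1 qr_walk qr'_walk.
    by have [-> ->] := last_passage_unique E gq.1 gq'.1 gr.1 gr'.1.
  + by have [-> ->] := last_passage_unique E gp.1 gp'.1 gq.1 gq'.1.
  + by have [-> ->] := last_passage_unique E gq.1 gq'.1 gr.1 gr'.1.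
  + by rewrite E.
- case=> [x|] [p|] [q|] [r|] //= _ _ _ _ _ [];
    by [case/add_run_unique | move=> nilE; case: (add_run_nil (esym nilE))].
- case=> [s|] // [s0 s_ddd] _.
  have [->|s_n0] := eqVneq s [::]; first by left; exists None.
  have [w [x [j [sE x_up]]]] := add_run_exists s0 s_n0.
  have xd : x != step_d by case/orP: x_up => /eqP->.
  have lt_j3 : j < 3.
    rewrite ltnNge; apply/negP => le_3j; move/negP: s_ddd; apply.
    by rewrite sE infix_ddd_cat // -(subnK le_3j) nseqD suffix_infix orbT.
  have w_ddd : ~~ infix ddd w.
    by move: s_ddd; rewrite sE infix_ddd_cat // negb_or => /andP[].
  have [m wm jE] : exists2 m, walk 0 w = Some m & m + (x == step_u) = j.
    move: s0; rewrite sE walk_cat; case: (walk 0 w) => [m|] //= runE.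
    exists m => //; case/orP: x_up runE => /eqP-> /=; rewrite walk_downs ?addn1 ?addn0;
      case: leqP => // le_jm [/eqP]; rewrite subn_eq0 => le_mj;
      by apply/eqP; rewrite eqn_leq le_jm andbT.
  case/orP: x_up jE => /eqP xE; rewrite xE in sE *.
  + rewrite addn1 => jE; right; case: j jE sE lt_j3 => // j [mE] sE.
    rewrite {m}mE in wm; case: j wm sE => [|[|//]] wm sE _.
      by exists None, (Some w), None; rewrite sE.
    have [p [q [wE p0 q0]]] := last_passage wm.
    rewrite wE in w_ddd; have [p_ddd q_ddd] := no_ddd_unglue w_ddd.
    by exists None, (Some p), (Some q); rewrite sE wE.
  + rewrite addn0 => jE; rewrite {m}jE in wm.
    case: j wm sE lt_j3 => [|[|[|//]]] wm sE _.
    * by left; exists (Some w); rewrite ?sE.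
    * right; have [p [q [wE p0 q0]]] := last_passage wm.
      rewrite wE in w_ddd; have [p_ddd q_ddd] := no_ddd_unglue w_ddd.
      by exists (Some p), (Some q), None; rewrite sE wE.
    * right; have [p [w' [wE p0 w'1]]] := last_passage wm.
      rewrite wE in w_ddd; have [p_ddd w'_ddd] := no_ddd_unglue w_ddd.
      have [q [r [w'E q0 r0]]] := last_passage w'1.
      rewrite w'E in w'_ddd; have [q_ddd r_ddd] := no_ddd_unglue w'_ddd.
      by exists (Some p), (Some q), (Some r); rewrite sE wE w'E.
Qed.

Lemma optional_paths_schroder n :
  equipotent (set_type [set o | optional_path o /\ optional_size o = n.+1]%classic)
    (set_type (schroder_paths_no_ddd n)).
Proof.
apply: (equipotent_sets (f := odflt [::])).
- case=> [p|] [] //= [p0 p_ddd] [pn]; split=> //; exact/schroder_pathsP.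
- by case=> [p|] [q|] [] // _ _ [] // _ _ /= ->.
- move=> p [/schroder_pathsP[p0 pn] p_ddd]; exists (Some p) => //.
  by split=> //=; rewrite pn.
Qed.

(** * The seven families *)

Theorem theorem1p1 (n : nat) (A B : Type) :
  let models : seq Type :=
    [:: set_type (F_paths n);
        set_type (schroder_paths_no_ddd n);
        set_type (restricted_bicolored_dyck_paths n.+1);
        set_type (avoiding_perms n.+1
          [:: [:: 2; 3; 4; 1]; [:: 2; 4; 3; 1]; [:: 3; 2; 4; 1]]);
        set_type (inversion_sequences_101_102 n.+1);
        set_type (inversion_sequences_101_021 n.+1);
        set_type (weighted_trees n.+1)] in
  List.In A models -> List.In B models ->
  exists f : A -> B, bijective f.
Proof.
move=> models A_in B_in.
have codes_shapes : equipotent (set_type (codes n)) (set_type (shapes n.+1)).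
  apply: equipotent_trans (codes_weighted_forests n) _.
  exact: equipotent_sym (shapes_weighted_forests n.+1).
have codes_models C : List.In C models -> equipotent (set_type (codes n)) C.
  case=> [<-|[<-|[<-|[<-|[<-|[<-|[<-|[]]]]]]]].
  - exact: codes_F_paths.
  - apply: equipotent_trans codes_shapes _.
    apply: equipotent_trans (shapes_optional_paths n.+1) _.
    exact: optional_paths_schroder.
  - exact: codes_bicolored.
  - apply: equipotent_trans codes_shapes _.
    apply: equipotent_trans (shapes_good_perms n.+1) _.
    exact: good_perms_avoiding.
  - exact: codes_101_102.
  - exact: codes_101_021.
  - apply: equipotent_trans (codes_weighted_forests n) _.
    exact: weighted_forests_trees.
exact: equipotent_trans (equipotent_sym (codes_models A A_in)) (codes_models B B_in).
Qed.
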